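(* The distribution of the family $(M_r)_{r\geq1}$ is characterized by the fact that, for all $p\geq1$ and all vectors $r=(r_1,\ldots,r_p)$ of positive integers, its mixed moments are given by $$\varphi(M_{r_1}M_{r_2}\cdots M_{r_p})=\#\,NC_2(r),$$ and its free cumulants are given by $$\kappa_p(M_{r_1},M_{r_2},\ldots,M_{r_p})=\#\,NC_2^*(r).$$
   Context: The family $(M_r)_{r\geq 1}$: let $\mathcal{S}$ be the group of finitely supported permutations of the nonnegative integers and $\mathbb{C}[\mathcal{S}]$ its group algebra with canonical trace $\sum_\sigma x_\sigma\sigma\mapsto x_{\mathrm{id}}$. For $r,n\geq1$ let $M_r(n,1)=n^{-r/2}\sum(0\,a_1\,a_2\cdots a_r)$, the sum running over all $r$-tuples of pairwise distinct integers of $[1,n]$, where $(0\,a_1\cdots a_r)$ is the cycle $0\to a_1\to\cdots\to a_r\to0$. Then $(M_r)_{r\geq1}$ is a family of self-adjoint elements of a non-commutative probability space $(\mathcal{A},\varphi)$ whose non-commutative distribution (the map $P\mapsto\varphi(P((M_r)_r))$ on non-commutative polynomials) is the pointwise limit, as $n\to\infty$, of that of $(M_r(n,1))_{r\geq1}$. Equivalently, $M_1$ is a standard semi-circular element and $M_r=U_r(M_1)$, where $U_r$ are the Chebyshev polynomials of the second kind: $U_0=1$, $U_1(x)=x$, $U_1U_n=U_{n-1}+U_{n+1}$ for $n\geq1$. $\kappa_p$ denotes the free cumulants, as defined by the usual moment–free cumulant formula over non-crossing partitions. Combinatorial sets: for $r=(r_1,\ldots,r_p)$ a vector of positive integers,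 $|r|=r_1+\cdots+r_p$, and $f_r:\{1,\ldots,|r|\}\to\{1,\ldots,p\}$ is given by $f_r(x)=k$ if and only if $r_1+\cdots+r_{k-1}<x\leq r_1+\cdots+r_k$. Let $\hat 1_r$ be the partition of $\{1,\ldots,|r|\}$ into the level sets $f_r^{-1}(1),\ldots,f_r^{-1}(p)$, $\hat 0_{|r|}$ the partition of $\{1,\ldots,|r|\}$ into singletons, and $\hat 1_{|r|}$ the one-block partition. $NC_2(r)$ is the set of non-crossing pairings $\pi$ of $\{1,\ldots,|r|\}$ with $\pi\wedge\hat 1_r=\hat 0_{|r|}$, i.e. which do not link two elements having the same image by $f_r$. $NC_2^*(r)=\{\pi\in NC_2(r):\pi\vee\hat 1_r=\hat 1_{|r|}\}$. Here $\wedge,\vee$ are the meet and join of partitions, and $\#$ denotes cardinality. *)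

(* Defs.v *)
From HB Require Import structures.
From mathcomp Require Import all_boot all_order all_algebra finmap.
From mathcomp Require Import boolp classical_sets functions cardinality reals.
From mathcomp Require Import topology normedtype sequences.
From mathcomp Require Import complex.

Set Implicit Arguments.
Unset Strict Implicit.
Unset Printing Implicit Defensive.

Import Order.TTheory GRing.Theory Num.Theory.
Import numFieldNormedType.Exports.

(* set0, setT, [set _ | _] are those of finset.v unless %classic is written. *)
Import mathcomp.boot.finset.
Local Open Scope ring_scope.

Notation posnat := {n : nat | (0 < n)%N}.

Section MonoidAlgebra.
Variables (K : monoidType) (C : comNzRingType).

Definition monoid_alg : predArgType := {fsfun K -> C with 0}.
HB.instance Definition _ := Choice.on monoid_alg.

Implicit Types (x y z : monoid_alg) (g h : K) (c : C).

Definition coef g x : C := (x : {fsfun K -> C with 0}) g.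
Definition supp x : {fset K} := finsupp (x : {fsfun K -> C with 0}).

Lemma monoid_algP x y : (forall g, coef g x = coef g y) <-> x = y.
Proof. by split=> [h|-> //]; apply/fsfunP/h. Qed.

Lemma coef_supp x g : (coef g x != 0) = (g \in supp x).
Proof. by rewrite mem_finsupp. Qed.

Lemma coef_out x g : g \notin supp x -> coef g x = 0.
Proof. exact: fsfun_dflt. Qed.

Definition scaled_basis c g : monoid_alg :=
  [fsfun h in [fset g]%fset => c].

Lemma coef_basis c g h : coef h (scaled_basis c g) = c *+ (g == h).
Proof. by rewrite /coef fsfun_fun in_fset1 eq_sym; case: eqP. Qed.

Lemma supp_basis c g : (supp (scaled_basis c g) `<=` [fset g])%fset.
Proof.
apply/fsubsetP=> h; rewrite in_fset1; apply: contraTT => /negPf gh.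
by rewrite -coef_supp coef_basis [g == h]eq_sym gh mulr0n eqxx.
Qed.

Definition ma_zero : monoid_alg := [fsfun].
Definition ma_opp x : monoid_alg := [fsfun g in supp x => - coef g x].
Definition ma_add x y : monoid_alg :=
  [fsfun g in (supp x `|` supp y)%fset => coef g x + coef g y].
Definition ma_scale c x : monoid_alg := [fsfun g in supp x => c * coef g x].

Lemma coef_zero g : coef g ma_zero = 0.
Proof. by rewrite /coef fsfun0E. Qed.

Lemma coef_opp g x : coef g (ma_opp x) = - coef g x.
Proof.
by rewrite {1}/coef fsfun_fun; case: ifPn => // /coef_out->; rewrite oppr0.
Qed.

Lemma coef_add g x y : coef g (ma_add x y) = coef g x + coef g y.
Proof.
rewrite {1}/coef fsfun_fun; case: ifPn => //.
by rewrite in_fsetU negb_or => /andP[/coef_out-> /coef_out->]; rewrite addr0.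
Qed.

Lemma coef_scale g c x : coef g (ma_scale c x) = c * coef g x.
Proof.
by rewrite {1}/coef fsfun_fun; case: ifPn => // /coef_out->; rewrite mulr0.
Qed.

Lemma ma_addA : associative ma_add.
Proof. by move=> x y z; apply/monoid_algP=> g; rewrite !coef_add addrA. Qed.
Lemma ma_addC : commutative ma_add.
Proof. by move=> x y; apply/monoid_algP=> g; rewrite !coef_add addrC. Qed.
Lemma ma_add0 : left_id ma_zero ma_add.
Proof.
by move=> x; apply/monoid_algP=> g; rewrite coef_add coef_zero add0r.
Qed.
Lemma ma_addN : left_inverse ma_zero ma_opp ma_add.
Proof.
by move=> x; apply/monoid_algP=> g; rewrite coef_add coef_zero coef_opp addNr.
Qed.

HB.instance Definition _ :=
  GRing.isZmodule.Build monoid_alg ma_addA ma_addC ma_add0 ma_addN.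

Lemma coefD g x y : coef g (x + y) = coef g x + coef g y.
Proof. exact: coef_add. Qed.

Lemma coef0 g : coef g 0 = 0.
Proof. exact: coef_zero. Qed.

Lemma coef_sum g (I : Type) (r : seq I) (P : pred I) (F : I -> monoid_alg) :
  coef g (\sum_(i <- r | P i) F i) = \sum_(i <- r | P i) coef g (F i).
Proof. exact: (big_morph (coef g) (coefD g) (coef0 g)). Qed.

Lemma ma_scaleA c1 c2 x : ma_scale c1 (ma_scale c2 x) = ma_scale (c1 * c2) x.
Proof. by apply/monoid_algP=> g; rewrite !coef_scale mulrA. Qed.
Lemma ma_scale1 : left_id 1 ma_scale.
Proof. by move=> x; apply/monoid_algP=> g; rewrite coef_scale mul1r. Qed.
Lemma ma_scaleDr : right_distributive ma_scale +%R.
Proof.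
by move=> c x y; apply/monoid_algP=> g; rewrite !(coef_scale, coefD) mulrDr.
Qed.
Lemma ma_scaleDl x : {morph ma_scale^~ x : c1 c2 / c1 + c2}.
Proof.
by move=> c1 c2; apply/monoid_algP=> g; rewrite !(coef_scale, coefD) mulrDl.
Qed.

HB.instance Definition _ := GRing.Zmodule_isLmodule.Build C monoid_alg
  ma_scaleA ma_scale1 ma_scaleDr ma_scaleDl.

Lemma coefZ g c x : coef g (c *: x) = c * coef g x.
Proof. exact: coef_scale. Qed.

Lemma basisD g : {morph scaled_basis^~ g : c1 c2 / c1 + c2}.
Proof.
by move=> c1 c2; apply/monoid_algP=> h; rewrite coefD !coef_basis mulrnDl.
Qed.

Lemma basis0 g : scaled_basis 0 g = 0.
Proof. by apply/monoid_algP=> h; rewrite coef_basis coef0 mul0rn. Qed.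

Lemma scale_basis c c' g : c *: scaled_basis c' g = scaled_basis (c * c') g.
Proof.
by apply/monoid_algP=> h; rewrite coefZ !coef_basis mulrnAr.
Qed.

Lemma monoid_algE x : x = \sum_(g <- supp x) scaled_basis (coef g x) g.
Proof.
apply/monoid_algP=> g; rewrite coef_sum.
have [gx|gx] := boolP (g \in supp x).
  rewrite (big_fsetD1 g) //= coef_basis eqxx big1_fset ?addr0 // => h.
  by rewrite in_fsetD1 coef_basis; case: eqP.
rewrite big1_fset ?coef_out // => h hx _.
by rewrite coef_basis; case: eqP => // hg; rewrite -hg hx in gx.
Qed.

Definition ma_one : monoid_alg := scaled_basis 1 1%g.
Fact ma_mul_key : unit. Proof. by []. Qed.
Definition ma_mul x y : monoid_alg := locked_with ma_mul_key
  (\sum_(g <- supp x) \sum_(h <- supp y)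
     scaled_basis (coef g x * coef h y) (g * h)%g).

Lemma ma_mul_def x y : ma_mul x y = \sum_(g <- supp x) \sum_(h <- supp y)
  scaled_basis (coef g x * coef h y) (g * h)%g.
Proof. by rewrite /ma_mul locked_withE. Qed.

Lemma ma_mulw (d1 d2 : {fset K}) x y :
  (supp x `<=` d1)%fset -> (supp y `<=` d2)%fset ->
  ma_mul x y = \sum_(g <- d1) \sum_(h <- d2)
     scaled_basis (coef g x * coef h y) (g * h)%g.
Proof.
move=> le1 le2; rewrite ma_mul_def (big_fset_incl _ le1) /=.
  apply/eq_bigr=> g _; apply/big_fset_incl => // h _ /coef_out ->.
  by rewrite mulr0 basis0.
by move=> g _ /coef_out gx; rewrite big1 // => h _; rewrite gx mul0r basis0.
Qed.

Lemma supp0 : supp 0 = fset0.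
Proof. exact: finsupp0. Qed.

Lemma suppD x y : (supp (x + y)%R `<=` supp x `|` supp y)%fset.
Proof.
apply/fsubsetP=> g; rewrite in_fsetU; apply: contraTT.
rewrite negb_or => /andP[/coef_out gx /coef_out gy].
by rewrite -coef_supp coefD gx gy addr0 eqxx.
Qed.

Lemma ma_mulDl : left_distributive ma_mul +%R.
Proof.
move=> x y z; rewrite (ma_mulw (suppD x y) (fsubset_refl _)).
rewrite (ma_mulw (fsubsetUl _ (supp y)) (fsubset_refl (supp z))).
rewrite (ma_mulw (fsubsetUr (supp x) _) (fsubset_refl (supp z))).
rewrite -big_split; apply: eq_bigr=> g _; rewrite -big_split.
by apply: eq_bigr=> h _; rewrite coefD mulrDl basisD.
Qed.

Lemma ma_mulDr : right_distributive ma_mul +%R.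
Proof.
move=> x y z; rewrite (ma_mulw (fsubset_refl _) (suppD y z)).
rewrite (ma_mulw (fsubset_refl (supp x)) (fsubsetUl _ (supp z))).
rewrite (ma_mulw (fsubset_refl (supp x)) (fsubsetUr (supp y) _)).
rewrite -big_split; apply: eq_bigr=> g _; rewrite -big_split.
by apply: eq_bigr=> h _; rewrite coefD mulrDr basisD.
Qed.

Lemma ma_mul0x : left_zero 0 ma_mul.
Proof. by move=> x; rewrite ma_mul_def supp0 big_seq_fset0. Qed.

Lemma ma_mulx0 : right_zero 0 ma_mul.
Proof.
by move=> x; rewrite ma_mul_def big1 // => g _; rewrite supp0 big_seq_fset0.
Qed.

Lemma ma_mul_basis c c' g h :
  ma_mul (scaled_basis c g) (scaled_basis c' h) =
  scaled_basis (c * c') (g * h)%g.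
Proof.
rewrite (ma_mulw (supp_basis _ _) (supp_basis _ _)) !big_seq_fset1.
by rewrite !coef_basis !eqxx.
Qed.

Lemma ma_mul_suml y (I : Type) (r : seq I) (F : I -> monoid_alg) :
  ma_mul (\sum_(i <- r) F i) y = \sum_(i <- r) ma_mul (F i) y.
Proof.
exact: (big_morph (ma_mul^~ y) (fun a b => ma_mulDl a b y) (ma_mul0x y)).
Qed.

Lemma ma_mul_sumr y (I : Type) (r : seq I) (F : I -> monoid_alg) :
  ma_mul y (\sum_(i <- r) F i) = \sum_(i <- r) ma_mul y (F i).
Proof. exact: (big_morph (ma_mul y) (ma_mulDr y) (ma_mulx0 y)). Qed.

Lemma ma_mul1x : left_id ma_one ma_mul.
Proof.
move=> x; rewrite [in LHS](monoid_algE x) [RHS]monoid_algE ma_mul_sumr.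
by apply: eq_bigr=> g _; rewrite ma_mul_basis mul1r mul1g.
Qed.

Lemma ma_mulx1 : right_id ma_one ma_mul.
Proof.
move=> x; rewrite [in LHS](monoid_algE x) [RHS]monoid_algE ma_mul_suml.
by apply: eq_bigr=> g _; rewrite ma_mul_basis mulr1 mulg1.
Qed.

Lemma ma_mulA : associative ma_mul.
Proof.
move=> x y z; rewrite (monoid_algE x) !ma_mul_suml; apply: eq_bigr=> g _.
rewrite (monoid_algE y) ma_mul_suml !ma_mul_sumr ma_mul_suml.
apply: eq_bigr=> h _; rewrite (monoid_algE z) !ma_mul_sumr.
by apply: eq_bigr=> k _; rewrite !ma_mul_basis mulrA mulgA.
Qed.

Lemma ma_one_neq0 : ma_one != 0.
Proof.
apply/eqP=> /monoid_algP/(_ 1%g)/eqP.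
by rewrite coef_basis eqxx coef0 oner_eq0.
Qed.

HB.instance Definition _ := GRing.Zmodule_isNzRing.Build monoid_alg
  ma_mulA ma_mul1x ma_mulx1 ma_mulDl ma_mulDr ma_one_neq0.

Lemma ma_mulE x y : x * y = \sum_(g <- supp x) \sum_(h <- supp y)
  scaled_basis (coef g x * coef h y) (g * h)%g.
Proof. exact: ma_mul_def. Qed.

Lemma ma_scaleAl c x y : c *: (x * y) = (c *: x) * y.
Proof.
rewrite (monoid_algE x) scaler_sumr !mulr_suml scaler_sumr.
apply: eq_bigr=> g _; rewrite (monoid_algE y) !mulr_sumr scaler_sumr.
apply: eq_bigr=> h _; rewrite scale_basis.
by rewrite ![_ * _ in LHS]ma_mul_basis ![_ * _ in RHS]ma_mul_basis
  scale_basis mulrA.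
Qed.

Lemma ma_scaleAr c x y : c *: (x * y) = x * (c *: y).
Proof.
rewrite (monoid_algE x) !mulr_suml scaler_sumr.
apply: eq_bigr=> g _; rewrite (monoid_algE y) scaler_sumr !mulr_sumr scaler_sumr.
apply: eq_bigr=> h _; rewrite scale_basis.
by rewrite ![_ * _ in LHS]ma_mul_basis ![_ * _ in RHS]ma_mul_basis
  scale_basis mulrCA.
Qed.

HB.instance Definition _ :=
  GRing.Lmodule_isLalgebra.Build C monoid_alg ma_scaleAl.
HB.instance Definition _ :=
  GRing.Lalgebra_isAlgebra.Build C monoid_alg ma_scaleAr.

Definition basis g : monoid_alg := scaled_basis 1 g.

End MonoidAlgebra.

Lemma basisM (K : monoidType) (C : comNzRingType) (g h : K) :
  basis C g * basis C h = basis C (g * h)%g.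
Proof. by rewrite [LHS]ma_mul_basis mul1r. Qed.

Section FreeMonoid.
Variable I : choiceType.

Definition free_monoid : predArgType := seq I.
HB.instance Definition _ := Choice.on free_monoid.
HB.instance Definition _ := isMonoid.Build free_monoid
  (@catA I) (@cat0s I) (@cats0 I).

End FreeMonoid.

(* Non-commutative polynomials in indeterminates (X_r), r >= 1. *)
Definition nc_poly (R : realType) := monoid_alg (free_monoid posnat) R[i].

Definition nc_eval (R : realType) (A : algType R[i]) (M : posnat -> A)
    (P : nc_poly R) : A :=
  \sum_(w <- supp P) coef w P *: \prod_(r <- (w : seq posnat)) M r.

Record nc_prob_space (R : realType) := NCProbSpace {
  nc_alg :> algType R[i];
  star : nc_alg -> nc_alg;
  starD : {morph star : a b / a + b};
  starZ : forall (c : R[i]) a, star (c *: a) = c^* *: star a;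
  starM : forall a b, star (a * b) = star b * star a;
  starK : involutive star;
  state : {scalar nc_alg};
  state1 : state 1 = 1;
  state_ge0 : forall a, 0 <= state (star a * a)
}.

Definition self_adjoint (R : realType) (A : nc_prob_space R) (a : A) :=
  star a = a.

Definition is_finperm (f : nat -> nat) : Prop :=
  bijective f /\ finite_set [set x | f x != x]%classic.

Definition finperm : predArgType := {f : nat -> nat | `[< is_finperm f >]}.
HB.instance Definition _ := Choice.on finperm.

Lemma finpermP (s : finperm) : is_finperm (val s).
Proof. exact: (asboolW (valP s)). Qed.

Lemma is_finperm1 : is_finperm id.
Proof.
split; first by exists id.
by rewrite (_ : [set _ | _]%classic = classical_sets.set0) //;
  apply/seteqP; split=> x //=; rewrite eqxx.
Qed.

Lemma is_finpermM f g : is_finperm f -> is_finperm g -> is_finperm (f \o g).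
Proof.
move=> [bf ff] [bg fg]; split; first exact: bij_comp.
have ffg : finite_set ([set x | f x != x] `|` [set x | g x != x])%classic.
  by rewrite finite_setU.
apply: sub_finite_set ffg => x /=.
by case: (eqVneq (g x) x) => [->|]; [left | right].
Qed.

Lemma is_finpermV (f g : nat -> nat) :
  cancel f g -> cancel g f -> is_finperm f -> is_finperm g.
Proof.
move=> fK gK [_ ff]; split; first by exists f.
apply: sub_finite_set ff => x /=; apply: contra_neq => fx.
by rewrite -{1}fx fK.
Qed.

Lemma finperm_inv_ex (s : finperm) : exists g : nat -> nat,
  [/\ cancel (val s) g, cancel g (val s) & is_finperm g].
Proof.
have [[g fK gK] _] := finpermP s; exists g; split => //.
exact: is_finpermV fK gK (finpermP s).
Qed.

Definition finperm_one : finperm := Sub id (asboolT is_finperm1).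
Definition finperm_mul (s t : finperm) : finperm :=
  Sub (val s \o val t) (asboolT (is_finpermM (finpermP s) (finpermP t))).
Definition finperm_inv (s : finperm) : finperm :=
  let: exist g gP := cid (finperm_inv_ex s) in
  let: And3 _ _ h := gP in Sub g (asboolT h).

Lemma finperm_mulA : associative finperm_mul.
Proof. by move=> s t u; apply: val_inj. Qed.
Lemma finperm_mul1 : left_id finperm_one finperm_mul.
Proof. by move=> s; apply: val_inj. Qed.
Lemma finperm_mulr1 : right_id finperm_one finperm_mul.
Proof. by move=> s; apply: val_inj. Qed.
Lemma finperm_mulV : left_inverse finperm_one finperm_inv finperm_mul.
Proof.
move=> s; apply: val_inj; rewrite /finperm_inv; case: cid => g [fK gK gP] /=.
exact/funext.
Qed.
Lemma finperm_mulrV : right_inverse finperm_one finperm_inv finperm_mul.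
Proof.
move=> s; apply: val_inj; rewrite /finperm_inv; case: cid => g [fK gK gP] /=.
exact/funext.
Qed.

HB.instance Definition _ := isGroup.Build finperm
  finperm_mulA finperm_mul1 finperm_mulr1 finperm_mulV finperm_mulrV.

(* The cycle x_1 -> x_2 -> ... -> x_k -> x_1 when c = [:: x_1; ...; x_k] has
   no repetition; next c fixes the points outside c. *)
Definition cycle_perm (c : seq nat) : finperm := insubd finperm_one (next c).

Lemma cycle_permE (c : seq nat) : uniq c -> val (cycle_perm c) = next c.
Proof.
move=> Uc; rewrite val_insubd ifT //; apply/asboolP; split.
  exact: Bijective (prev_next Uc) (next_prev Uc).
apply: (@sub_finite_set _ _ [set` c]%classic) => [x /=|].
  by apply: contra_neqT => xc; rewrite next_nth (negPf xc).
exact: finite_seq.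
Qed.

Definition group_alg (R : realType) := monoid_alg finperm R[i].

Definition canonical_trace (R : realType) (x : group_alg R) : R[i] :=
  coef 1%g x.

(* M_r(n,1); the tuple entry a_j in 'I_n encodes the integer a_j + 1 of [1,n]. *)
Definition Mrn (R : realType) (n : nat) (r : posnat) : group_alg R :=
  (Num.sqrt (n%:R : R) ^- val r)%:C%C *:
    \sum_(a : (val r).-tuple 'I_n | uniq a)
      basis R[i] (cycle_perm (0%N :: [seq (val i).+1 | i <- a])).

(* (A, phi, M) has the limiting distribution of (M_r(n,1))_r as n -> oo. *)
Definition is_limit_family (R : realType) (A : nc_prob_space R)
    (M : posnat -> A) : Prop :=
  forall P : nc_poly R,
    (canonical_trace (nc_eval (@Mrn R n) P) @[n --> \oo]
       --> (state A (nc_eval M P) : R[i]^o))%classic.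

Definition same_distribution (R : realType) (A B : nc_prob_space R)
    (M : posnat -> A) (N : posnat -> B) : Prop :=
  forall P : nc_poly R, state A (nc_eval M P) = state B (nc_eval N P).

Section Partitions.
Variable T : finType.
Implicit Types P Q S : {set {set T}}.

Definition refines P Q : bool := [forall B in P, exists C in Q, B \subset C].

Definition part_meet P Q : {set {set T}} :=
  [set B :&: C | B in P, C in Q] :\ set0.

Definition same_block P : rel T := fun x y => y \in pblock P x.

(* The blocks of the join are the classes of the equivalence relation
   generated by "being in the same block of P or of Q". *)
Definition part_join P Q : {set {set T}} :=
  equivalence_partition
    (connect (fun x y => same_block P x y || same_block Q x y)) [set: T].

Let part P := partition P [set: T].

Lemma part_meet_partition P Q : part P -> part Q -> part (part_meet P Q).
Proof.
move=> /and3P[/eqP cP tP P0] /and3P[/eqP cQ tQ Q0]; apply/and3P; split.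
- apply/eqP/setP=> x; rewrite inE; apply/bigcupP.
  have xP : x \in cover P by rewrite cP.
  have xQ : x \in cover Q by rewrite cQ.
  exists (pblock P x :&: pblock Q x); last by rewrite inE !mem_pblock xP.
  rewrite !inE imset2_f ?pblock_mem // andbT.
  by apply/set0Pn; exists x; rewrite inE !mem_pblock xP.
- apply/trivIsetP=> _ _ /setD1P[_ /imset2P[B C BP CQ ->]]
    /setD1P[_ /imset2P[B' C' BP' CQ' ->]] neq.
  rewrite -setI_eq0; apply: contraNT neq => /set0Pn[x].
  rewrite !inE => /andP[/andP[xB xC] /andP[xB' xC']].
  by rewrite -(def_pblock tP BP xB) -(def_pblock tP BP' xB')
    -(def_pblock tQ CQ xC) -(def_pblock tQ CQ' xC').
- by rewrite !inE eqxx.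
Qed.

Lemma part_meet_glb P Q S : part P -> part Q -> part S ->
  refines S (part_meet P Q) = refines S P && refines S Q.
Proof.
move=> pP pQ /and3P[_ _ S0].
apply/idP/andP=> [/'forall_implyP h|[/'forall_implyP hP /'forall_implyP hQ]].
  split; apply/'forall_implyP=> B /h /exists_inP[_ /setD1P[_ /imset2P[C D CP DQ ->]]];
    rewrite subsetI => /andP[BC BD]; apply/exists_inP.
  - by exists C.
  - by exists D.
apply/'forall_implyP=> B BS.
have /exists_inP[C CP BC] := hP _ BS; have /exists_inP[D DQ BD] := hQ _ BS.
apply/exists_inP; exists (C :&: D); last by rewrite subsetI BC.
rewrite !inE imset2_f // andbT.
have /set0Pn[x xB] : B != set0 by apply: contraNneq S0 => <-.
by apply/set0Pn; exists x; rewrite inE (fintype.subsetP BC) // (fintype.subsetP BD).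
Qed.

Lemma same_blockP P S : part P -> part S ->
  reflect (forall x y, same_block P x y -> same_block S x y) (refines P S).
Proof.
move=> /and3P[/eqP cP tP P0] /and3P[/eqP cS tS _].
apply: (iffP 'forall_implyP) => [h x y xy|h B BP].
  have xP : x \in cover P by rewrite cP.
  have /exists_inP[C CS sC] := h _ (pblock_mem xP).
  have xC : x \in C by apply: (fintype.subsetP sC); rewrite mem_pblock.
  by rewrite /same_block (def_pblock tS CS xC); apply: (fintype.subsetP sC).
have /set0Pn[x xB] : B != set0 by apply: contraNneq P0 => <-.
apply/exists_inP; exists (pblock S x); first by rewrite pblock_mem ?cS.
apply/fintype.subsetP=> y yB; apply: h.
by rewrite /same_block (def_pblock tP BP xB).
Qed.

Lemma same_block_sym P : part P -> symmetric (same_block P).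
Proof.
move=> /and3P[/eqP cP tP _] x y.
by rewrite /same_block -!eq_pblock ?cP // eq_sym.
Qed.

Lemma part_join_equiv P Q : part P -> part Q ->
  {in [set: T] & &, equivalence_rel
    (connect (fun x y => same_block P x y || same_block Q x y))}.
Proof.
move=> pP pQ x y z _ _ _; set e := (fun _ => _).
have se : connect_sym e.
  by apply: sym_connect_sym => a b; rewrite /e !(same_block_sym _ a b).
by split=> [|xy]; [exact: connect0 | exact: (same_connect se xy)].
Qed.

Lemma part_join_partition P Q : part P -> part Q -> part (part_join P Q).
Proof. by move=> pP pQ; apply/equivalence_partitionP/part_join_equiv. Qed.

Lemma same_block_join P Q x y : part P -> part Q ->
  same_block (part_join P Q) x y =
  connect (fun x y => same_block P x y || same_block Q x y) x y.
Proof.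
move=> pP pQ; rewrite /same_block pblock_equivalence_partition //.
exact: part_join_equiv.
Qed.

Lemma part_join_lub P Q S : part P -> part Q -> part S ->
  refines (part_join P Q) S = refines P S && refines Q S.
Proof.
move=> pP pQ pS; have pJ := part_join_partition pP pQ.
apply/(same_blockP pJ pS)/andP=> [h|[/same_blockP hP /same_blockP hQ] x y].
  by split; apply/same_blockP=> // x y xy; apply: h; rewrite same_block_join //;
    apply: connect1; rewrite xy ?orbT.
rewrite same_block_join // => /connectP[p + ->]; have [cS tS _] := and3P pS.
elim: p x => [|z p IHp] x /=.
  by move=> _; rewrite /same_block mem_pblock (eqP cS).
move=> /andP[xz /IHp]; rewrite /same_block -!eq_pblock ?(eqP cS) // => /eqP<-.
rewrite eq_pblock ?(eqP cS) //.
by case/orP: xz; [exact: hP | exact: hQ].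
Qed.

End Partitions.

Section NonCrossing.
Variable m : nat.
Implicit Types P : {set {set 'I_m}}.

Definition noncrossing P : bool :=
  [forall B in P, forall C in P, (B != C) ==>
     ~~ [exists a in B, exists b in C, exists c in B, exists d in C,
           [&& (a < b)%N, (b < c)%N & (c < d)%N]]].

Definition NC : {set {set {set 'I_m}}} :=
  [set P | partition P [set: 'I_m] && noncrossing P].

Definition pairing P : bool :=
  partition P [set: 'I_m] && [forall B in P, #|B| == 2].

Definition hat0 : {set {set 'I_m}} := [set [set x] | x : 'I_m].
Definition hat1 : {set {set 'I_m}} := [set [set: 'I_m]].

End NonCrossing.

Definition weight (r : seq posnat) : nat := (\sum_(k <- r) val k)%N.

(* The level set of f_r of index k, with both {1..|r|} and {1..p} shifted to
   start at 0: r_1 + ... + r_k <= x < r_1 + ... + r_(k+1). *)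
Definition level_set (r : seq posnat) (k : nat) : {set 'I_(weight r)} :=
  [set x : 'I_(weight r) | (weight (take k r) <= x < weight (take k.+1 r))%N].

Definition hat1_vec (r : seq posnat) : {set {set 'I_(weight r)}} :=
  [set level_set r k | k : 'I_(size r)].

Lemma weight_cat r s : weight (r ++ s) = (weight r + weight s)%N.
Proof. exact: big_cat. Qed.

Lemma weight_take r i j : (i <= j)%N ->
  (weight (take i r) <= weight (take j r))%N.
Proof.
by move=> ij; rewrite -(subnKC ij) takeD weight_cat leq_addr.
Qed.

Lemma level_set_uniq r (x : 'I_(weight r)) i j :
  x \in level_set r i -> x \in level_set r j -> i = j.
Proof.
wlog ij : i j / (i <= j)%N => [hw|].
  by case/orP: (leq_total i j) => ? ? ?; [|apply/esym]; apply: hw.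
rewrite !inE => /andP[_ x1] /andP[x2 _]; apply/eqP; rewrite eqn_leq ij /=.
rewrite leqNgt; apply/negP=> /(weight_take r) ji.
by have := leq_trans x1 (leq_trans ji x2); rewrite ltnn.
Qed.

Lemma hat1_vec_partition r : partition (hat1_vec r) [set: 'I_(weight r)].
Proof.
apply/and3P; split.
- apply/eqP/setP=> x; rewrite inE; apply/bigcupP.
  have ex : exists k, (x < weight (take k.+1 r))%N.
    by exists (size r); rewrite take_oversize.
  have xk := ex_minnP ex; case: xk => k xk kmin.
  have kr : (k < size r)%N.
    case: r x {ex} xk kmin => [|a r] x xk kmin.
      by case: x {xk kmin} => x /=; rewrite /weight big_nil.
    by apply: (kmin (size r)); rewrite take_oversize.
  exists (level_set r k); first exact: (imset_f _ (x := Ordinal kr)).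
  rewrite inE xk andbT; case: k xk kmin {kr} => [|k] xk kmin.
    by rewrite take0 /weight big_nil.
  by rewrite leqNgt; apply/negP=> /kmin; rewrite ltnn.
- apply/trivIsetP=> _ _ /imsetP[i _ ->] /imsetP[j _ ->] neq.
  rewrite -setI_eq0; apply: contraNT neq => /set0Pn[x].
  by rewrite inE => /andP[xi xj]; rewrite (level_set_uniq xi xj).
- apply/imsetP=> -[k _ /setP k0].
  have lt_k : (weight (take k r) < weight (take k.+1 r))%N.
    set x0 := tnth (in_tuple r) k.
    rewrite (take_nth x0) // -cats1 weight_cat -addn1 leq_add2l.
    by rewrite /weight big_seq1; exact: valP (nth x0 r k).
  have lt_kr : (weight (take k r) < weight r)%N.
    apply: leq_trans lt_k _.
    by have := weight_take r (ltn_ord k); rewrite take_size.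
  by have := k0 (Ordinal lt_kr); rewrite !inE /= leqnn lt_k.
Qed.

Definition NC2 (r : seq posnat) : {set {set {set 'I_(weight r)}}} :=
  [set P | [&& pairing P, noncrossing P &
              part_meet P (hat1_vec r) == hat0 (weight r)]].

Definition NC2star (r : seq posnat) : {set {set {set 'I_(weight r)}}} :=
  [set P in NC2 r | part_join P (hat1_vec r) == hat1 (weight r)].

Section FreeCumulants.
Variables (R : realType) (A : nc_prob_space R).
Implicit Types (a : seq A).

(* (a_i)_{i \in V}, in increasing order of i *)
Definition restrict a (V : {set 'I_(size a)}) : seq A :=
  [seq tnth (in_tuple a) i | i <- enum V].

(* The moment-free cumulant formula solved for its one-block term; the first
   argument only bounds the depth of the recursion. *)
Fixpoint free_cumulant_rec (n : nat) (a : seq A) : R[i] :=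
  if n is n'.+1 then
    state A (\prod_(x <- a) x)
    - \sum_(P in NC (size a) | P != hat1 (size a))
        \prod_(V in P) free_cumulant_rec n' (restrict V)
  else 0.

Definition free_cumulant a : R[i] := free_cumulant_rec (size a) a.

Lemma size_restrict a (V : {set 'I_(size a)}) : size (restrict V) = #|V|.
Proof. by rewrite size_map -cardE. Qed.

Lemma restrictT a : restrict [set: 'I_(size a)] = a.
Proof.
rewrite /restrict (eq_enum (in_set _)) -[RHS](map_tnth_enum (in_tuple a)).
by rewrite enumT.
Qed.

Lemma NC_proper_block m (P : {set {set 'I_m}}) V :
  P \in NC m -> P != hat1 m -> V \in P -> (0 < #|V| < m)%N.
Proof.
rewrite inE => /andP[/and3P[_ tP P0] _] nP VP.
rewrite card_gt0 (contraNneq _ P0) => [|<-] //=.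
have := max_card V; rewrite card_ord ltn_neqAle => ->; rewrite andbT.
apply: contra nP => cV; have VT : V = [set: 'I_m].
  by apply/eqP; rewrite eqEcard subsetT cardsT card_ord (eqP cV) leqnn.
rewrite eqEsubset; apply/andP; split; apply/fintype.subsetP=> W; rewrite !inE.
  move=> WP; apply: contraNT P0 => nW; suff <- : W = set0 by [].
  have VW : V != W by rewrite VT eq_sym.
  have := trivIsetP tP _ _ VP WP VW; rewrite VT -setI_eq0 setTI.
  by move/eqP.
by move/eqP->; rewrite -VT.
Qed.

Lemma free_cumulant_recE n a : (0 < size a <= n)%N ->
  free_cumulant_rec n a = free_cumulant a.
Proof.
elim/ltn_ind: n a => -[|n] IHn a; first by case: (size a).
move=> /andP[a0 an].
rewrite /free_cumulant -[X in _ = free_cumulant_rec X a](prednK a0) /=.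
congr (_ - _); apply: eq_bigr=> P /andP[PNC nP]; apply: eq_bigr=> V VP.
have /andP[V0 Vk] := NC_proper_block PNC nP VP.
have Vk' : (#|V| <= (size a).-1)%N by rewrite -ltnS prednK.
have an' : ((size a).-1 <= n)%N by rewrite -ltnS prednK.
rewrite IHn ?size_restrict ?V0 ?(leq_trans Vk') //.
by rewrite IHn ?size_restrict ?V0 ?Vk'.
Qed.

Theorem moment_free_cumulant a : (0 < size a)%N ->
  state A (\prod_(x <- a) x) =
  \sum_(P in NC (size a)) \prod_(V in P) free_cumulant (restrict V).
Proof.
move=> a0; have h1 : hat1 (size a) \in NC (size a).
  rewrite inE; apply/andP; split.
    apply/and3P; split; rewrite ?inE.
    - by rewrite /cover big_set1.
    - by apply/trivIsetP=> B C; rewrite !inE => /eqP-> /eqP->; rewrite eqxx.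
    - rewrite eq_sym -card_gt0 cardsT card_ord //.
  apply/'forall_implyP=> B; rewrite inE => /eqP->.
  by apply/'forall_implyP=> C; rewrite inE => /eqP->; rewrite eqxx.
rewrite (bigD1 _ h1) /= big_set1 restrictT.
rewrite -[X in X + _](@free_cumulant_recE (size a)) ?a0 ?leqnn //.
rewrite -[X in free_cumulant_rec X a](prednK a0) /=.
rewrite [X in _ - X + _](_ : _ = \sum_(P in NC (size a) | P != hat1 (size a))
   \prod_(V in P) free_cumulant (restrict V)) ?subrK //.
apply: eq_bigr=> P /andP[PNC nP]; apply: eq_bigr=> V VP.
have /andP[V0 Vk] := NC_proper_block PNC nP VP.
by rewrite free_cumulant_recE // size_restrict V0 -ltnS prednK.
Qed.

End FreeCumulants.

(* Main.v *)
Require Import Defs.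
From HB Require Import structures.
From mathcomp Require Import all_boot all_order all_algebra finmap.
From mathcomp Require Import boolp classical_sets functions cardinality reals.
From mathcomp Require Import topology normedtype sequences.
From mathcomp Require Import complex.
From mathcomp Require Import realfun zify.

(* With tau_a = (0 a), the cycle (0 a_1 ... a_r) is tau_{a_r} o ... o tau_{a_1}.
   After reversing each tuple, the trace of M_{r_1}(n,1) ... M_{r_p}(n,1) is
   therefore n^{-|r|/2} times the number of words w in [1,n]^{|r|} that have no
   repeated letter inside a block of r and satisfy tau_{w_1} ... tau_{w_|r|} = id.
   Every letter of such a word occurs at least twice, so up to a vanishing
   proportion the letters are paired; and the product attached to a paired word
   is the identity exactly when the pairing is non-crossing.  Hence the moments
   converge to #NC_2(r).
   For the cumulants, the arcs of a pairing in NC_2(r) connect the blocks of r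
   along a non-crossing partition Q of {1,...,p}, and the pairings inducing Q are
   the families of elements of the NC_2^*(r restricted to V), V in Q.  Thus
   #NC_2^* satisfies the moment-cumulant formula with moments #NC_2, and this
   formula determines moments and cumulants from each other. *)

Set Implicit Arguments.
Unset Strict Implicit.
Unset Printing Implicit Defensive.

Import Order.TTheory GRing.Theory Num.Theory.
Import numFieldNormedType.Exports.
Import mathcomp.boot.finset.

(** * Words in the transpositions (0 a) *)

Definition star_transp (a z : nat) : nat :=
  if z == 0 then a else if z == a then 0 else z.

(** [foldr] lets the last letter act first, so a word acts as the composite of its transpositions in
    reading order. *)
Definition act (w : seq nat) (z : nat) : nat := foldr star_transp z w.

Lemma star_transpK a : involutive (star_transp a).
Proof.
move=> z; rewrite /star_transp.
case: (eqVneq z 0) => [->|z0]; first by rewrite eqxx; case: eqP.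
by case: (eqVneq z a) => [->|za] //=; rewrite (negPf z0) (negPf za).
Qed.

Lemma act_cat s t z : act (s ++ t) z = act s (act t z).
Proof. by rewrite /act foldr_cat. Qed.

(** Each letter acts as an involution, so reversing a word inverts its action. *)
Lemma act_revK s : cancel (act s) (act (rev s)).
Proof.
move=> z; elim: s => //= a s IH; rewrite rev_cons -cats1 act_cat /=.
by rewrite star_transpK.
Qed.

Lemma act_inj s : injective (act s).
Proof. exact: can_inj (act_revK s). Qed.

Lemma act_notin s z : z != 0 -> z \notin s -> act s z = z.
Proof.
move=> z0; elim: s => //= a s IH; rewrite inE negb_or => /andP[za /IH->].
by rewrite /star_transp (negPf z0) (negPf za).
Qed.

(** A letter of [s] is sent to 0 by its own transposition and from there to its successor by the
    next transposition to act; distinctness keeps the other letters from moving it. *)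
Lemma act_rev_next s z : uniq (0 :: s) -> act (rev s) z = next (0 :: s) z.
Proof.
move=> /= /andP[s0 us].
have [->|z0] := eqVneq z 0.
  case: s s0 us => //= a s; rewrite inE negb_or => /andP[a0 _] /andP[as_ _].
  rewrite rev_cons -cats1 act_cat /= /star_transp /= act_notin ?mem_rev //.
  by rewrite eq_sym.
(* Here [y] is the point of the cycle from which [next_at] still searches; on the right-hand side it
   plays the part of 0. *)
suff h y : uniq (y :: s) -> next_at z 0 y s = act (rev s) (if z == y then 0 else z).
  by rewrite h /= ?s0 // (negPf z0).
elim: s y s0 us => [|a s IH] y /=; first by case: eqP.
rewrite inE negb_or eq_sym => /andP[a0 s0] /andP[as_ us] /andP[ys _].
rewrite IH //= ?as_ // rev_cons -cats1 act_cat /= /star_transp.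
have [//=|//] := eqVneq z y; last by rewrite (negPf z0).
by rewrite act_notin ?mem_rev.
Qed.

(** If [x] occurred once, the letters to its right would fix it and its own letter would send it to
    0; the letters to its left would then send both 0 and [x] to [x]. *)
Lemma act_id_count w x : 0 \notin w -> (forall z, act w z = z) -> x \in w ->
  1 < count_mem x w.
Proof.
move=> w0 wid xw; rewrite ltnNge; apply/negP.
have x0 : x != 0 by apply: contraNneq w0 => <-.
case/splitPr: xw w0 wid => s u w0 wid.
rewrite count_cat /= eqxx addnCA -[X in _ <= X]addn0 leq_add2l leqn0 addn_eq0.
move=> /andP[/eqP/count_memPn xs /eqP/count_memPn xu].
have := wid x; rewrite act_cat /= (act_notin x0 xu) /star_transp (negPf x0) eqxx.
by rewrite -[RHS](act_notin x0 xs) => /act_inj x0'; rewrite -x0' in x0.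
Qed.

(** The shortest suffix with a repetition begins with [x], and everything after this first [x] is
    duplicate-free. *)
Lemma not_uniq_gap (T : eqType) (w : seq T) : ~~ uniq w ->
  exists s x u v, w = s ++ x :: u ++ x :: v /\ uniq (x :: u).
Proof.
elim: w => //= a w IH; rewrite negb_and negbK.
have [uw|/IH[s [x [u [v [-> h]]]]] _] := boolP (uniq w); last first.
  by exists (a :: s), x, u, v.
rewrite orbF => aw; exists [::], a.
move: uw; rewrite -[w](cat_take_drop (index a w)) (drop_nth a) ?index_mem //.
rewrite nth_index // cat_uniq => /and3P[ut /hasPn n _].
exists (take (index a w) w), (drop (index a w).+1 w); split=> //=.
by rewrite ut andbT (n a) // mem_head.
Qed.

(* If S (0 x) U (0 x) V = id with x not in S, U, V then (0 x) U (0 x) = (VS)^-1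
   fixes x, so U fixes 0; a nonempty word in distinct letters moves 0. *)
Lemma act_id_gap s x u v : 0 \notin s ++ x :: u ++ x :: v -> x \notin s ->
  x \notin v -> uniq (x :: u) ->
  (forall z, act (s ++ x :: u ++ x :: v) z = z) -> u = [::].
Proof.
rewrite mem_cat !inE mem_cat inE !negb_or.
case/and5P=> s0 x0 u0 _ v0 xs xv /= /andP[xu uu] wid.
have x0' : x != 0 by rewrite eq_sym.
have U0 : act u 0 = 0.
  have := wid x; rewrite act_cat /= act_cat /= (act_notin x0' xv).
  rewrite {2}/star_transp (negPf x0') eqxx.
  rewrite -[RHS](act_notin x0' xs) => /act_inj /(canRL (star_transpK x)) ->.
  by rewrite /star_transp (negPf x0') eqxx.
case/lastP: u u0 {wid xu} uu U0 => // u y.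
rewrite mem_rcons inE negb_or eq_sym => /andP[y0 u0].
rewrite rcons_uniq => /andP[yu _]; rewrite -cats1 act_cat /= act_notin // => e.
by rewrite [y](e : y = 0) in y0.
Qed.

(** * Paired words and their crossings *)

Definition paired (w : seq nat) := {in w, forall x, count_mem x w = 2}.

(** In a paired word [y] and [z] have no further occurrences, so the pattern is a crossing of two
    pairs. *)
Definition crossing (w : seq nat) :=
  exists y z, y != z /\ subseq [:: y; z; y; z] w.

Lemma paired_gap s x u v : paired (s ++ x :: u ++ x :: v) ->
  [/\ x \notin s, x \notin u & x \notin v].
Proof.
move=> /(_ x); rewrite mem_cat mem_head orbT => /(_ isT).
rewrite count_cat /= count_cat /= eqxx => e.
change (nat_of_bool true) with 1 in e.
have [es eu ev] : [/\ count_mem x s = 0, count_mem x u = 0 & count_mem x v = 0].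
  split; move: (count_mem x s) (count_mem x u) (count_mem x v) e => i j k e; lia.
by split; exact/count_memPn.
Qed.

Lemma paired_reduce s x v : paired (s ++ x :: x :: v) -> paired (s ++ v).
Proof.
move=> h; have [xs _ xv] := paired_gap (u := [::]) h; move=> z zsv.
have zx : (x == z) = false.
  by apply: contraTF zsv => /eqP<-; rewrite mem_cat negb_or xs.
have <- := h z; first by rewrite !count_cat /= zx.
by move: zsv; rewrite !mem_cat !inE => /orP[->|->]; rewrite ?orbT.
Qed.

Lemma subseq_skip (T : eqType) (x : T) t s v : x \notin s ->
  subseq (x :: t) (s ++ v) -> subseq (x :: t) v.
Proof.
elim: s => //= a s IH; rewrite inE negb_or => /andP[/negPf ax /IH h].
by rewrite ax.
Qed.

(** The only two occurrences of [x] are adjacent, so no letter fits between them and a crossing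
    cannot use [x]. *)
Lemma crossing_reduce s x v : paired (s ++ x :: x :: v) ->
  crossing (s ++ x :: x :: v) <-> crossing (s ++ v).
Proof.
move=> h; have [xs _ xv] := paired_gap (u := [::]) h.
have nx z : z != x -> subseq [:: x; z; x] (s ++ x :: x :: v) -> false.
  move=> zx /(subseq_skip xs); rewrite /= eqxx (negPf zx) => /mem_subseq/(_ x).
  by rewrite !inE eqxx orbT (negPf xv) => /(_ isT).
split=> -[y [z [yz sub]]]; exists y, z; split=> //; last first.
  apply: subseq_trans sub _.
  by rewrite cat_subseq // -[_ :: _ :: v]/([:: x; x] ++ v) suffix_subseq.
have tl a t w : subseq (a :: t) w -> subseq t w.
  by move=> atw; exact: subseq_trans (subseq_cons _ _) atw.
have [yx|yx] := eqVneq y x.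
  rewrite yx in yz sub; suff: false by []; apply: (nx z); first by rewrite eq_sym.
  by apply: subseq_trans sub; rewrite (prefix_subseq [:: x; z; x] [:: z]).
have [zx|zx] := eqVneq z x.
  by rewrite zx in sub; suff: false by []; apply: (nx y) => //; exact: tl sub.
(* A pattern avoiding [x] survives the deletion of all the letters [x]. *)
have : subseq [:: y; z; y; z] [seq a <- s ++ x :: x :: v | a != x].
  by rewrite subseq_filter sub andbT /= yx zx.
rewrite filter_cat /= eqxx /= -filter_cat => /subseq_trans; apply.
exact: filter_subseq.
Qed.

Lemma act_reduce s x v z : act (s ++ x :: x :: v) z = act (s ++ v) z.
Proof. by rewrite !act_cat /= star_transpK. Qed.

(** Induction on the length, using a repetition [x u x] with distinct letters in [x u]. If [u] is
    empty, [x x] can be deleted on both sides of the equivalence. Otherwise both sides fail: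
    [act_id_gap] excludes the identity, and the first letter of [u] crosses [x]. *)
Lemma act_id_noncrossing w : 0 \notin w -> paired w ->
  (forall z, act w z = z) <-> ~ crossing w.
Proof.
have [n] := ubnP (size w); elim: n w => // n IH w; rewrite ltnS => szw w0 pw.
case: w => [|a w] in szw w0 pw *.
  by split=> // _ [y [z [_ /=]]].
have /not_uniq_gap [s [x [u [v [e ux]]]]] : ~~ uniq (a :: w).
  apply/negP=> /(count_uniq_mem a); rewrite mem_head => e.
  by have := pw a (mem_head _ _); rewrite e.
rewrite e in szw w0 pw *; have [xs xu xv] := paired_gap pw.
have [u0|u0] := eqVneq u [::].
  rewrite u0 /= in szw w0 pw *; rewrite crossing_reduce //.
  rewrite -IH; first by split=> h z; have := h z; rewrite act_reduce.
  - by move: szw; rewrite !size_cat /=; lia.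
  - by move: w0; rewrite !mem_cat !inE !negb_or => /and4P[-> _ _ ->].
  - exact: paired_reduce pw.
split=> [wid|nc]; first by rewrite (act_id_gap w0 xs xv ux wid) in u0.
case: u u0 {szw w0 e IH} ux xu pw nc => // y u _ /= /and3P[_ yu uu].
rewrite inE negb_or => /andP[xy _] pw [].
(* The first letter [y] of the gap does not recur inside it, so its partner lies in [s] or in [v],
   which produces [y x y x] or [x y x y]. *)
have : count_mem y s + count_mem y v = 1.
  have := pw y; rewrite mem_cat !inE eqxx !orbT => /(_ isT).
  rewrite count_cat /= count_cat /= eqxx (negPf xy) (count_memPn yu) /=.
  by move: (count_mem y s) (count_mem y v) => i j; lia.
have -> : s ++ [:: x, y & u ++ x :: v] = s ++ [:: x; y] ++ u ++ [:: x] ++ v by [].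
have [/count_memPn->|/negPn ys _] := boolP (y \notin s).
  have [/count_memPn->//|] := boolP (y \notin v).
  rewrite negbK => yv _; exists x, y; split=> //.
  apply: subseq_trans (suffix_subseq s _).
  rewrite -[[:: x; y; x; y]]/([:: x; y] ++ [::] ++ [:: x] ++ [:: y]).
  by rewrite !cat_subseq ?sub0seq ?sub1seq ?mem_head ?subseq_refl.
exists y, x; split; first by rewrite eq_sym.
rewrite -[[:: y; x; y; x]]/([:: y] ++ [:: x; y] ++ [::] ++ [:: x] ++ [::]).
by rewrite !cat_subseq ?sub0seq ?sub1seq ?mem_head ?subseq_refl.
Qed.

Lemma subseq_nth (x0 a : nat) (t w : seq nat) :
  subseq (a :: t) w <->
  exists i, [/\ i < size w, nth x0 w i = a & subseq t (drop i.+1 w)].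
Proof.
elim: w => [|b w IH] /=; first by split=> // -[i []].
have [<-|ba] := eqVneq b a.
  split=> [h|[i [_ _ /subseq_trans]]]; first by exists 0; rewrite /= drop0.
  by apply; rewrite drop_subseq.
rewrite IH; split=> [[i [h1 h2 h3]]|[[|i] //= [h1 h2 h3]]]; first by exists i.+1.
  by rewrite h2 eqxx in ba.
by exists i.
Qed.

Lemma crossing_nth w : crossing w <-> exists i j k l,
  [/\ [&& i < j, j < k, k < l & l < size w], nth 0 w i = nth 0 w k,
      nth 0 w j = nth 0 w l & nth 0 w i != nth 0 w j].
Proof.
split=> [[y [z [yz]]]|[i [j [k [l [/and4P[ij jk kl ls] eik ejl nij]]]]]].
  move=> /(subseq_nth 0) [i [i1 i2]] /(subseq_nth 0) [j [j1 j2]].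
  move=> /(subseq_nth 0) [k [k1 k2]] /(subseq_nth 0) [l [l1 l2 _]].
  rewrite !drop_drop !size_drop !nth_drop in j1 j2 k1 k2 l1 l2.
  (* Each index was found in the part of [w] left after the previous one, hence the accumulated
     offsets. *)
  exists i, (i.+1 + j), (j.+1 + i.+1 + k), (k.+1 + (j.+1 + i.+1) + l).
  rewrite k2 l2 i2 j2; split=> //.
  by move: i1 l1; move: (size w) => N i1 l1; lia.
exists (nth 0 w i), (nth 0 w j); split=> //.
apply/(subseq_nth 0); exists i; split=> //; first by lia.
apply/(subseq_nth 0); exists (j - i.+1); rewrite size_drop nth_drop drop_drop.
rewrite subnKC //; split=> //; first by lia.
rewrite (_ : (j - i.+1).+1 + i.+1 = j.+1); last by lia.
apply/(subseq_nth 0); exists (k - j.+1); rewrite size_drop nth_drop drop_drop.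
rewrite subnKC //; split=> //; first by lia.
rewrite (_ : (k - j.+1).+1 + j.+1 = k.+1); last by lia.
apply/(subseq_nth 0); exists (l - k.+1); rewrite size_drop nth_drop drop_drop.
by rewrite subnKC //; split; rewrite ?sub0seq //; lia.
Qed.

(** * Non-crossing pairings as involutions *)

Lemma connect_closed (T : finType) (e : rel T) (P : pred T) x y :
  (forall u v, e u v -> P u -> P v) -> connect e x y -> P x -> P y.
Proof.
move=> h /connectP[p + ->]; elim: p x => //= a p IH x /andP[xa ap] Px.
exact: IH ap (h _ _ xa Px).
Qed.

Section Arcs.
Variables (m p : nat) (lev : 'I_m -> 'I_p).
Implicit Types (f g : {ffun 'I_m -> 'I_m}) (V : {set 'I_p}).

(* A non-crossing pairing, without arcs inside a level, of the positions whose
   level lies in V is encoded as the involution that exchanges the two ends of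
   each arc and fixes the other positions. *)
Definition arcs V : {set {ffun 'I_m -> 'I_m}} :=
  [set f : {ffun 'I_m -> 'I_m} | [forall x, [&& f (f x) == x,
      (lev x \in V) ==> (lev (f x) != lev x) & (lev x \notin V) ==> (f x == x)]]
    && [forall x : 'I_m, forall y : 'I_m, ~~ [&& x < y, y < f x & f x < f y]]].

Lemma arcsP V f : reflect
  [/\ forall x, f (f x) = x, forall x, lev x \in V -> lev (f x) != lev x,
      forall x, lev x \notin V -> f x = x
    & forall x y : 'I_m, x < y -> y < f x -> f x < f y -> False]
  (f \in arcs V).
Proof.
rewrite inE; apply: (iffP andP) => [[/forallP h /forallP nc]|[h1 h2 h3 nc]].
  split=> [x|x xV|x xV|x y xy yf ff].
  - by have /and3P[/eqP] := h x.
  - by have /and3P[_ /implyP-> ] := h x.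
  - by have /and3P[_ _ /implyP/(_ xV)/eqP] := h x.
  - by have /forallP/(_ y) := nc x; rewrite xy yf ff.
split; apply/forallP=> x; last first.
  by apply/forallP=> y; apply/and3P=> -[xy yf /(nc _ _ xy yf)].
by rewrite h1 eqxx /=; apply/andP; split; apply/implyP; [exact: h2 | move/h3/eqP].
Qed.

(** Its connected components are the classes of the join of the pairing with the partition into
    levels. *)
Definition link f : rel 'I_m := fun x y => (y == f x) || (lev x == lev y).

(** Models [NC2star] for the levels in [V]. Arcs of an element of [arcs V] do not leave these
    levels, so paths in the whole of ['I_m] may be allowed. *)
Definition conn_arcs V : {set {ffun 'I_m -> 'I_m}} :=
  [set f in arcs V | [forall x, forall y,
     (lev x \in V) ==> (lev y \in V) ==> connect (link f) x y]].

Lemma conn_arcsP V f : reflect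
  (f \in arcs V /\ forall x y, lev x \in V -> lev y \in V -> connect (link f) x y)
  (f \in conn_arcs V).
Proof.
apply: (iffP setIdP) => -[fV h]; split=> //.
  by move=> x y xV yV; move/forallP/(_ x)/forallP/(_ y): h; rewrite xV yV.
by apply/forallP=> x; apply/forallP=> y; apply/implyP=> xV; apply/implyP; exact: h.
Qed.

Lemma arcs_lev V f x : f \in arcs V -> (lev (f x) \in V) = (lev x \in V).
Proof.
move=> /arcsP[ff _ fo _]; apply/idP/idP; apply: contraTT => h.
  by rewrite fo.
by rewrite -(ff x) fo // ff.
Qed.

Lemma link_sym V f : f \in arcs V -> symmetric (link f).
Proof.
move=> /arcsP[ff _ _ _] x y; rewrite /link [lev x == _]eq_sym; congr (_ || _).
by apply/eqP/eqP=> ->; rewrite ff.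
Qed.

Lemma link_connect_sym V f : f \in arcs V -> connect_sym (link f).
Proof. by move=> fV; apply/sym_connect_sym/link_sym/fV. Qed.

Definition restr V f : {ffun 'I_m -> 'I_m} :=
  [ffun x => if lev x \in V then f x else x].

Lemma restr_arcs V f : f \in arcs [set: 'I_p] ->
  (forall x, lev x \in V -> lev (f x) \in V) -> restr V f \in arcs V.
Proof.
move=> /arcsP[ff fl _ nc] fV; apply/arcsP; split=> [x|x xV|x /negPf xV|x y].
- have [xV|/negPf xV] := boolP (lev x \in V); last by rewrite !(ffunE, xV).
  by rewrite !(ffunE, xV) fV.
- by rewrite ffunE xV fl ?inE.
- by rewrite ffunE xV.
rewrite !ffunE; case: ifP => _ xy yfx; last by have := ltn_trans xy yfx; rewrite ltnn.
by case: ifP => _; [exact: nc | move=> /(ltn_trans yfx); rewrite ltnn].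
Qed.

(** * The partition of the levels induced by a pairing *)

Hypothesis lev_mono : forall x y : 'I_m, x <= y -> lev x <= lev y.
Variable st : 'I_p -> 'I_m.
Hypothesis stK : cancel st lev.

Lemma lev_lt x y : lev x < lev y -> x < y.
Proof. by apply: contraTT; rewrite -!leqNgt; apply: lev_mono. Qed.

Lemma connect_lev f x y : lev x = lev y -> connect (link f) x y.
Proof. by move=> e; apply: connect1; rewrite /link e eqxx orbT. Qed.

(** The partition [Q] of the levels. The representatives [st k] make it a partition of ['I_p]; by
    [mem_components] their choice is immaterial. *)
Definition components f : {set {set 'I_p}} :=
  equivalence_partition (fun k l => connect (link f) (st k) (st l)) [set: 'I_p].

Lemma components_equiv V f : f \in arcs V ->
  {in [set: 'I_p] & &, equivalence_rel (fun k l => connect (link f) (st k) (st l))}.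
Proof.
move=> /link_connect_sym sf x y z _ _ _; split; first exact: connect0.
by move=> xy; exact: (same_connect sf xy).
Qed.

Lemma mem_components V f x y : f \in arcs V ->
  (lev y \in pblock (components f) (lev x)) = connect (link f) x y.
Proof.
move=> fV; rewrite pblock_equivalence_partition ?inE //; last exact: components_equiv fV.
apply/idP/idP=> h.
  apply: connect_trans (connect_trans h _); apply: connect_lev; by rewrite stK.
apply: connect_trans (connect_trans h _); apply: connect_lev; by rewrite stK.
Qed.

Lemma components_partition V f : f \in arcs V -> partition (components f) [set: 'I_p].
Proof. by move=> fV; apply/equivalence_partitionP; exact: components_equiv fV. Qed.

(* Of the arcs joining level a to level c some arc (x, f x) separates the levels
   b and d, and of those joining b to d some arc then crosses (x, f x). *)
Lemma components_noncrossing V f : f \in arcs V -> noncrossing (components f).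
Proof.
move=> fV; have sf := link_connect_sym fV; have pf := components_partition fV.
have [ff _ _ nc] := arcsP _ _ fV.
have [_ tf _] := and3P pf.
apply/forall_inP=> B BQ; apply/forall_inP=> C CQ; apply/implyP=> BC.
apply/existsP=> -[a /andP[aB /existsP[b /andP[bC /existsP[c /andP[cB
  /existsP[d /and4P[dC ab bc cd]]]]]]]].
have conn k l D : D \in components f -> k \in D -> l \in D -> connect (link f) (st k) (st l).
  move=> DQ kD lD; rewrite -(mem_components _ _ fV) !stK.
  by rewrite (def_pblock tf DQ kD).
have cross : ~~ connect (link f) (st a) (st b).
  apply: contra BC; rewrite -(mem_components _ _ fV) !stK => bB.
  rewrite -(def_pblock tf CQ bC) -(def_pblock tf BQ aB).
  by rewrite eq_pblock // (cover_partition pf) inE.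
have ncx k l : connect (link f) (st a) k -> connect (link f) (st b) l ->
    lev k != lev l.
  move=> ak bl; apply: contra cross => /eqP kl; apply: connect_trans ak _.
  by apply: connect_trans (connect_lev f kl) _; rewrite sf.
pose inside (x : 'I_m) := (b < lev x < d).
have lnk x y : link f x y = (f x == y) || (lev x == lev y) by rewrite /link eq_sym.
(* A path from level [a] to level [c] has to enter the levels strictly between [b] and [d], and only
   an arc can change the level. *)
have [x [ax xo xi]] : exists x,
    [/\ connect (link f) (st a) x, ~~ inside x & inside (f x)].
  apply: contrapT => h.
  have : connect (link f) (st a) (st c) && ~~ inside (st c).
    apply: (connect_closed (e := link f) (x := st a)
      (P := fun x => connect (link f) (st a) x && ~~ inside x)).
    - move=> u v; rewrite lnk => /orP uv /andP[au uo].
      have luv : link f u v by rewrite lnk; case: uv => ->; rewrite ?orbT.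
      rewrite (connect_trans au (connect1 luv)) /=.
      case: uv => /eqP e; last by rewrite /inside -e.
      by apply/negP; rewrite -e => fi; apply: h; exists u.
    - exact: conn BQ aB cB.
    - by rewrite connect0 /inside stK negb_and -leqNgt (ltnW ab).
  by rewrite /inside stK bc cd andbF.
have bd := conn _ _ _ CQ bC dC.
(* Orient this arc so that exactly one of [b], [d] lies between its ends. Its ends are not on the
   levels [b], [d], which belong to another component; this makes the inequalities strict. *)
have [u [v [fu fv au av bd_in]]] : exists u v, [/\ f u = v, f v = u,
    connect (link f) (st a) u, connect (link f) (st a) v
    & (lev u < b < lev v) != (lev u < d < lev v)].
  have afx : connect (link f) (st a) (f x).
    by apply: connect_trans ax (connect1 _); rewrite lnk eqxx.
  have := ncx _ _ ax (connect0 _ _); have := ncx _ _ ax bd.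
  rewrite !stK => /eqP xd /eqP xb.
  have {}xb : lev x <> b :> nat by move/val_inj.
  have {}xd : lev x <> d :> nat by move/val_inj.
  move: xi xo; rewrite /inside => /andP[bfx fxd]; rewrite negb_and -!leqNgt.
  case/orP=> h.
    have xb' : lev x < b by rewrite ltn_neqAle h andbT; apply/eqP.
    exists x, (f x); split=> //.
    by rewrite xb' bfx (leq_gtF (ltnW fxd)) andbF.
  have dx : d < lev x by rewrite ltn_neqAle h andbT eq_sym; apply/eqP.
  exists (f x), x; split=> //.
  by rewrite fxd dx (leq_gtF (ltnW bfx)).
pose ins (y : 'I_m) := lev u < lev y < lev v.
(* A path from [b] to [d] must therefore cross the boundary of the interval of levels between [u]
   and [v], again by an arc. *)
have [y [by_ yi yo]] : exists y, [/\ connect (link f) (st b) y, ins y & ~~ ins (f y)].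
  apply: contrapT => h.
  have : connect (link f) (st b) (st d) && (ins (st d) == ins (st b)).
    apply: (connect_closed (e := link f) (x := st b)
      (P := fun y => connect (link f) (st b) y && (ins y == ins (st b)))) => //.
    - move=> y z; rewrite lnk => /orP yz /andP[bY /eqP<-].
      have lyz : link f y z by rewrite lnk; case: yz => ->; rewrite ?orbT.
      have bz := connect_trans bY (connect1 lyz); rewrite bz /=.
      case: yz => /eqP e; last by rewrite /ins e.
      have [hz|hz] := boolP (ins z); have [hy|hy] := boolP (ins y) => //.
        by case: h; exists z; rewrite -[in f z]e ff.
      by case: h; exists y; rewrite e.
    - by rewrite connect0 eqxx.
  by rewrite bd /ins !stK eq_sym (negPf bd_in).
have bfy : connect (link f) (st b) (f y).
  by apply: connect_trans by_ (connect1 _); rewrite lnk eqxx.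
have [uy yv] := andP yi.
have := ncx _ _ au bfy; have := ncx _ _ av bfy; move=> /eqP nv /eqP nu.
have {}nu : lev u <> lev (f y) :> nat by move/val_inj.
have {}nv : lev v <> lev (f y) :> nat by move/val_inj.
move: yo; rewrite /ins negb_and -!leqNgt => /orP[h|h].
  apply: (nc (f y) u); rewrite ?ff ?fu; apply: lev_lt => //.
  by rewrite ltn_neqAle h andbT eq_sym; apply/eqP.
apply: (nc u y); rewrite ?ff ?fu; apply: lev_lt => //.
by rewrite ltn_neqAle h andbT; apply/eqP.
Qed.

(** A path that starts in the component [V] never leaves it, so it only uses arcs kept by
    [restr V f]. *)
Lemma restr_conn f V : f \in arcs [set: 'I_p] -> V \in components f ->
  restr V f \in conn_arcs V.
Proof.
move=> fT Vf; have [_ tf _] := and3P (components_partition fT).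
have VE x : lev x \in V -> V = pblock (components f) (lev x).
  by move=> xV; rewrite (def_pblock tf Vf xV).
apply/conn_arcsP; split=> [|x y xV yV].
  apply: (restr_arcs fT) => x xV; rewrite (VE _ xV) (mem_components _ _ fT).
  by apply: connect1; rewrite /link eqxx.
have xy : connect (link f) x y by rewrite -(mem_components _ _ fT) -VE.
suff /andP[] : (lev y \in V) && connect (link (restr V f)) x y by [].
apply: (connect_closed (e := link f) (x := x) (y := y)
  (P := fun z => (lev z \in V) && connect (link (restr V f)) x z)) => //.
  move=> u v uv /andP[uV xu].
  have vV : lev v \in V.
    by rewrite (VE _ uV) (mem_components _ _ fT); exact: connect1.
  rewrite vV /=; apply: connect_trans xu (connect1 _).
  by rewrite /link ffunE uV.
by rewrite xV connect0.
Qed.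

(** * Gluing connected pairings along a non-crossing partition of the levels *)

Variable Q : {set {set 'I_p}}.
Hypothesis QNC : Q \in NC p.

Let Qpart : partition Q [set: 'I_p].
Proof. by move: QNC; rewrite inE => /andP[]. Qed.

Let Qtriv : trivIset Q. Proof. by have [] := and3P Qpart. Qed.

Let blk k : {set 'I_p} := pblock Q k.

Let blkQ k : blk k \in Q.
Proof. by rewrite pblock_mem // (cover_partition Qpart) inE. Qed.

Let blk_mem k : k \in blk k.
Proof. by rewrite mem_pblock (cover_partition Qpart) inE. Qed.

Let blkE V k : V \in Q -> k \in V -> blk k = V.
Proof. exact: def_pblock. Qed.

Definition glue (F : {set 'I_p} -> {ffun 'I_m -> 'I_m}) :
  {ffun 'I_m -> 'I_m} := [ffun x => F (pblock Q (lev x)) x].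

(** Two crossing arcs in one block would cross in some [F V]. In distinct blocks their ends have
    distinct levels, in the same order by monotonicity, so two blocks of [Q] would cross. *)
Lemma glue_arcs F : (forall V, V \in Q -> F V \in conn_arcs V) ->
  glue F \in arcs [set: 'I_p].
Proof.
move=> FV; have Fb x : F (blk (lev x)) \in arcs (blk (lev x)).
  by have /conn_arcsP[] := FV _ (blkQ (lev x)).
have mF x : lev (F (blk (lev x)) x) \in blk (lev x).
  by rewrite (arcs_lev _ (Fb x)) blk_mem.
have bF x : blk (lev (F (blk (lev x)) x)) = blk (lev x) by apply: blkE.
apply/arcsP; split=> [x|x _|x|x y]; last 2 first.
- by rewrite inE.
- rewrite !ffunE -!/(blk _) => xy yfx fxfy.
  have [e|nb] := eqVneq (blk (lev x)) (blk (lev y)).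
    have [_ _ _ nc] := arcsP _ _ (Fb x).
    by apply: (nc x y xy yfx); rewrite e; rewrite e in fxfy.
  have nlt u v : blk (lev u) != blk (lev v) -> u < v -> lev u < lev v.
    move=> n uv; rewrite ltn_neqAle lev_mono ?(ltnW uv) // andbT.
    by apply: contra n => /eqP/val_inj->.
  move: QNC; rewrite inE => /andP[_ /forall_inP/(_ _ (blkQ (lev x)))].
  move=> /forall_inP/(_ _ (blkQ (lev y))); rewrite nb => /existsP[].
  exists (lev x); rewrite blk_mem; apply/existsP; exists (lev y).
  rewrite blk_mem; apply/existsP; exists (lev (F (blk (lev x)) x)).
  rewrite mF; apply/existsP; exists (lev (F (blk (lev y)) y)).
  rewrite mF !nlt // ?bF //.
  by rewrite eq_sym.
- have [ff _ _ _] := arcsP _ _ (Fb x).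
  by rewrite !ffunE -!/(blk _) bF ff.
- have [_ fl _ _] := arcsP _ _ (Fb x).
  by rewrite ffunE -!/(blk _) fl.
Qed.

(** No arc of [glue F] leaves its block of [Q], and [F V] already connects all of [V]. *)
Lemma components_glue F : (forall V, V \in Q -> F V \in conn_arcs V) ->
  components (glue F) = Q.
Proof.
move=> FV; have gT := glue_arcs FV.
have h x : pblock (components (glue F)) (lev x) = blk (lev x).
  apply/setP=> k; rewrite -(stK k) (mem_components _ _ gT).
  move: (st k) => y; apply/idP/idP.
    move=> xy; have: lev x \in blk (lev x) by [].
    apply: (connect_closed (e := link (glue F)) (P := fun z => lev z \in blk (lev x))) xy.
    move=> u v /orP[/eqP->|/eqP->//] ux; rewrite ffunE.
    have e : pblock Q (lev u) = blk (lev x) by rewrite -/(blk _) (blkE (blkQ (lev x))).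
    have /conn_arcsP[Fa _] := FV _ (blkQ (lev x)).
    by rewrite e (arcs_lev _ Fa).
  move=> yx; have /conn_arcsP[Fa Fc] := FV _ (blkQ (lev x)).
  have xy := Fc x y (blk_mem _) yx.
  suff /andP[] : (lev y \in blk (lev x)) && connect (link (glue F)) x y by [].
  apply: (connect_closed (e := link (F (blk (lev x)))) (x := x) (y := y)
   (P := fun z => (lev z \in blk (lev x)) && connect (link (glue F)) x z)) => //.
    move=> u v uv /andP[ux xu]; have vx : lev v \in blk (lev x).
      by case/orP: uv => /eqP; [move=> ->; rewrite (arcs_lev _ Fa) | move=> <-].
    rewrite vx /=; apply: connect_trans xu (connect1 _).
    by rewrite /link ffunE -/(blk _) (blkE (blkQ (lev x)) ux).
  by rewrite blk_mem connect0.
apply/setP=> V; have pc := components_partition gT; have [_ tc _] := and3P pc.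
apply/idP/idP => VP.
  have /set0Pn[k kV] := partition_neq0 pc VP.
  by rewrite -(def_pblock tc VP kV) -(stK k) h blkQ.
have /set0Pn[k kV] := partition_neq0 Qpart VP.
rewrite -(blkE VP kV) -(stK k) -h pblock_mem //.
by rewrite (cover_partition pc) inE.
Qed.

(** Restriction to the blocks of [Q] and [glue] are inverse bijections between the fibre and the
    families of connected pairings. *)
Lemma card_components_fiber :
  #|[set f in arcs [set: 'I_p] | components f == Q]| = \prod_(V in Q) #|conn_arcs V|.
Proof.
(* A family indexed by [Q] is a function on all sets of levels, with the identity as default value
   off [Q]. *)
transitivity #|pfamily [ffun x => x] (mem Q) (fun V => mem (conn_arcs V))|; last first.
  by rewrite card_pfamily foldrE big_map big_enum.
pose to f : {ffun {set 'I_p} -> {ffun 'I_m -> 'I_m}} :=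
  [ffun V => if V \in Q then restr V f else [ffun x => x]].
rewrite -(card_in_imset (f := to)); last first.
  move=> f g _ _ /ffunP e; apply/ffunP=> x.
  have := e (blk (lev x)); rewrite !ffunE blkQ => /ffunP/(_ x).
  by rewrite !ffunE blk_mem.
apply: eq_card => F; apply/imsetP/pfamilyP.
  move=> [f]; rewrite inE => /andP[fT /eqP fQ] ->; split.
    by apply/supportP=> V VQ; rewrite ffunE (negPf VQ).
  by move=> V VQ; rewrite ffunE VQ /= restr_conn // fQ.
move=> [/supportP F0 FV]; exists (glue F).
  by rewrite inE glue_arcs // components_glue // eqxx.
apply/ffunP=> V; rewrite ffunE; case: ifPn => [VQ|/F0//].
have /conn_arcsP[/arcsP[_ _ F1 _] _] := FV _ VQ.
apply/ffunP=> x; rewrite !ffunE; case: ifPn => xV; last by rewrite F1.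
by rewrite -/(blk _) (blkE VQ xV).
Qed.

End Arcs.

(** Pairings are sorted by the partition they induce on the levels; this is the moment-cumulant
    formula for the cardinalities. *)
Lemma card_arcs m p (lev : 'I_m -> 'I_p) (st : 'I_p -> 'I_m) :
  (forall x y : 'I_m, x <= y -> lev x <= lev y) -> cancel st lev ->
  #|arcs lev [set: 'I_p]| =
  \sum_(Q in NC p) \prod_(V in Q) #|conn_arcs lev V|.
Proof.
move=> lm stK; rewrite -sum1_card (partition_big (components lev st) (mem (NC p))) /=.
  apply: eq_bigr => Q QNC; rewrite -(card_components_fiber lm stK QNC) -sum1_card.
  by apply: eq_bigl => f; rewrite inE.
move=> f fT; rewrite inE (components_partition st fT).
exact: (components_noncrossing lm stK fT).
Qed.

(** * Pairings and fixed-point-free involutions *)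

(** The block of the meet at [x] is the intersection of the two blocks at [x], which has to be
    [[set x]]. *)
Lemma part_meet_hat0 m (P H : {set {set 'I_m}}) :
  partition P [set: 'I_m] -> partition H [set: 'I_m] ->
  reflect (forall x y, same_block P x y -> same_block H x y -> y = x)
    (part_meet P H == hat0 m).
Proof.
move=> pP pH; have [cP tP P0] := and3P pP; have [cH tH H0] := and3P pH.
have inP x : x \in pblock P x by rewrite mem_pblock (eqP cP) inE.
have inH x : x \in pblock H x by rewrite mem_pblock (eqP cH) inE.
have PP x : pblock P x \in P by rewrite pblock_mem ?(eqP cP) ?inE.
have HH x : pblock H x \in H by rewrite pblock_mem ?(eqP cH) ?inE.
have meet x : pblock P x :&: pblock H x \in part_meet P H.
  rewrite in_setD1 imset2_f // andbT; apply/set0Pn; exists x.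
  by rewrite in_setI inP inH.
apply: (iffP eqP) => [e x y xy xyH|h].
  have := meet x; rewrite e => /imsetP[z _ /setP ez].
  have := ez x; rewrite in_setI inP inH in_set1 => /esym/eqP->.
  have := ez y; rewrite in_setI; rewrite /same_block in xy xyH.
  by rewrite xy xyH in_set1 => /esym/eqP->.
have meetE x : pblock P x :&: pblock H x = [set x].
  apply/setP=> y; rewrite in_setI in_set1; apply/andP/eqP => [[]|->] //.
  exact: h.
apply/setP=> B; apply/idP/imsetP => [|[x _ ->]]; last by rewrite -meetE.
rewrite in_setD1 => /andP[/set0Pn[x xB] /imset2P[C D CP DH BE]].
exists x => //; rewrite -meetE BE; move: xB; rewrite BE in_setI => /andP[xC xD].
by rewrite (def_pblock tP CP xC) (def_pblock tH DH xD).
Qed.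

(** The point [x0] rules out [m = 0], where the join is empty whereas [hat1] contains the empty
    block. *)
Lemma part_join_hat1 m (P H : {set {set 'I_m}}) (x0 : 'I_m) :
  partition P [set: 'I_m] -> partition H [set: 'I_m] ->
  reflect (forall x y, connect (fun x y => same_block P x y || same_block H x y) x y)
    (part_join P H == hat1 m).
Proof.
move=> pP pH; have pJ := part_join_partition pP pH.
have sb x y : same_block (part_join P H) x y =
    connect (fun x y => same_block P x y || same_block H x y) x y.
  exact: same_block_join.
have [/eqP cJ tJ J0] := and3P pJ.
apply: (iffP eqP) => [e x y|h].
  have : pblock (part_join P H) x \in part_join P H by rewrite pblock_mem ?cJ ?inE.
  by rewrite -sb /same_block {2}e in_set1 => /eqP->; rewrite inE.
have full x : pblock (part_join P H) x = [set: 'I_m].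
  by apply/setP=> y; rewrite inE; have := sb x y; rewrite h.
apply/setP=> B; rewrite in_set1; apply/idP/eqP => [BJ|->]; last first.
  by rewrite -(full x0) pblock_mem ?cJ ?inE.
have /set0Pn[x xB] := partition_neq0 pJ BJ.
by rewrite -(def_pblock tJ BJ xB) full.
Qed.

Section ArcBlocks.
Variable m : nat.
Implicit Types (f : {ffun 'I_m -> 'I_m}) (P : {set {set 'I_m}}).

Definition arc_blocks f : {set {set 'I_m}} := [set [set x; f x] | x : 'I_m].

Definition fixfree_inv f := (forall x, f (f x) = x) /\ (forall x, f x != x).

Lemma arc_block_eq f x y : fixfree_inv f -> x \in [set y; f y] ->
  [set x; f x] = [set y; f y].
Proof. by move=> [ff _] /set2P[->//|->]; rewrite ff setUC. Qed.

Lemma arc_blocks_partition f : fixfree_inv f ->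
  partition (arc_blocks f) [set: 'I_m].
Proof.
move=> hf; apply/and3P; split.
- apply/eqP/setP=> x; rewrite inE; apply/bigcupP.
  by exists [set x; f x]; [exact: imset_f | rewrite set21].
- apply/trivIsetP=> _ _ /imsetP[x _ ->] /imsetP[y _ ->]; apply: contraNT.
  rewrite -setI_eq0 => /set0Pn[z]; rewrite in_setI => /andP[zx zy].
  by rewrite -(arc_block_eq hf zx) -(arc_block_eq hf zy).
- by apply/imsetP=> -[x _ /setP/(_ x)]; rewrite set21 inE.
Qed.

Lemma pblock_arc_blocks f x : fixfree_inv f -> pblock (arc_blocks f) x = [set x; f x].
Proof.
move=> hf; have [_ tf _] := and3P (arc_blocks_partition hf).
by apply: def_pblock => //; [exact: imset_f | rewrite set21].
Qed.

Lemma arc_blocks_pairing f : fixfree_inv f -> pairing (arc_blocks f).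
Proof.
move=> hf; rewrite /pairing arc_blocks_partition //=; have [_ f0] := hf.
by apply/forall_inP=> _ /imsetP[x _ ->]; rewrite cards2 [x == _]eq_sym f0.
Qed.

Lemma pairing_arc_blocks P : pairing P ->
  exists2 f, fixfree_inv f & P = arc_blocks f.
Proof.
move=> /andP[pP /forall_inP P2]; have [/eqP cP tP P0] := and3P pP.
have inP x : x \in pblock P x by rewrite mem_pblock cP inE.
have PP x : pblock P x \in P by rewrite pblock_mem ?cP ?inE.
have ex x : exists y, (y != x) && (pblock P x == [set x; y]).
  have /eqP/cards2P[y [z [yz e]]] := eqP (P2 _ (PP x)).
  have := inP x; rewrite e => /set2P[->|->].
    by exists z; rewrite eq_sym yz eqxx.
  by exists y; rewrite yz setUC eqxx.
pose f := [ffun x => xchoose (ex x)].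
have fP x : f x != x /\ pblock P x = [set x; f x].
  by rewrite ffunE; have /andP[? /eqP] := xchooseP (ex x).
have hf : fixfree_inv f.
  split=> [x|x]; last by have [] := fP x.
  have [f1 e1] := fP x; have [f2 e2] := fP (f x).
  have e : pblock P x = pblock P (f x).
    apply/eqP; rewrite eq_pblock ?cP ?inE // e1; exact: set22.
  have := set22 (f x) (f (f x)); rewrite -e2 -e e1 => /set2P[//|e3].
  by rewrite e3 eqxx in f2.
exists f => //; apply/setP=> B; apply/idP/imsetP=> [BP|[x _ ->]]; last first.
  by have [_ <-] := fP x.
have /set0Pn[x xB] := partition_neq0 pP BP; exists x => //.
by rewrite -(def_pblock tP BP xB); have [] := fP x.
Qed.

(** Blocks have two points, so in a crossing [a < b < c < d] necessarily [c = f a] and [d = f b]. *)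
Lemma arc_blocks_noncrossing f : fixfree_inv f ->
  reflect (forall x y : 'I_m, x < y -> y < f x -> f x < f y -> False)
    (noncrossing (arc_blocks f)).
Proof.
move=> hf; have pf := arc_blocks_partition hf; have [/eqP cf tf _] := and3P pf.
have mem x : [set x; f x] \in arc_blocks f by exact: imset_f.
apply: (iffP forall_inP) => [nc x y xy yfx fxy|h].
  have /forall_inP/(_ _ (mem y)) := nc _ (mem x).
  have /negPf-> /= : [set x; f x] != [set y; f y].
    apply/eqP=> /setP/(_ y); rewrite set21 => /set2P[] /eqP; rewrite -val_eqE /=.
      by rewrite gtn_eqF.
    by rewrite ltn_eqF.
  case/existsP; exists x; rewrite set21; apply/existsP; exists y.
  rewrite set21; apply/existsP; exists (f x); rewrite set22.
  by apply/existsP; exists (f y); rewrite set22 xy yfx fxy.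
move=> _ /imsetP[x _ ->]; apply/forall_inP=> _ /imsetP[y _ ->].
apply/implyP=> ne; apply/existsP=> -[a /andP[aB /existsP[b /andP[bC /existsP[c
  /andP[cB /existsP[d /and4P[dC ab bc cd]]]]]]]].
have ca : c = f a.
  move: cB; rewrite -(arc_block_eq hf aB) => /set2P[] // e.
  by move: (ltn_trans ab bc); rewrite e ltnn.
have db : d = f b.
  move: dC; rewrite -(arc_block_eq hf bC) => /set2P[] // e.
  by move: (ltn_trans bc cd); rewrite e ltnn.
by apply: (h a b); rewrite -?ca -?db.
Qed.

Lemma arc_blocks_inj f g : fixfree_inv f -> fixfree_inv g ->
  arc_blocks f = arc_blocks g -> f = g.
Proof.
move=> hf hg e; apply/ffunP=> x; have := pblock_arc_blocks x hg.
rewrite -e pblock_arc_blocks // => /setP/(_ (f x)); rewrite set22.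
by move=> /esym/set2P[] // fx; have [_ /(_ x)] := hf; rewrite fx eqxx.
Qed.

End ArcBlocks.

Arguments arc_blocks {m} f.

(** * Restriction to a set of blocks *)

Section Relabel.
Variables (m p m' p' : nat) (lev : 'I_m -> 'I_p) (lev' : 'I_m' -> 'I_p').
Variables (V : {set 'I_p}) (h : 'I_m' -> 'I_m).
Hypothesis h_mono : forall x y : 'I_m', x < y -> h x < h y.
Hypothesis h_lev : forall x y, (lev (h x) == lev (h y)) = (lev' x == lev' y).
Hypothesis h_im : forall y, reflect (exists x, y = h x) (lev y \in V).

Let h_lt x y : (h x < h y) = (x < y).
Proof.
apply/idP/idP; last exact: h_mono.
apply: contraTT; rewrite -!leqNgt leq_eqVlt => /orP[/eqP/val_inj->//|].
by move/h_mono/ltnW.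
Qed.

Let h_inj : injective h.
Proof.
move=> x y e; apply/val_inj.
by case: (ltngtP x y) => // /h_mono; rewrite e ltnn.
Qed.

Let hV x : lev (h x) \in V. Proof. by apply/h_im; exists x. Qed.

(** The map [h] is an increasing bijection onto the positions with level in [V], and it preserves
    and reflects order and links. *)
Lemma conn_arcs_relabel (f : {ffun 'I_m -> 'I_m}) (f' : {ffun 'I_m' -> 'I_m'}) :
  (forall x, f (h x) = h (f' x)) -> (forall y, lev y \notin V -> f y = y) ->
  (f \in conn_arcs lev V) = (f' \in conn_arcs lev' [set: 'I_p']).
Proof.
move=> fh fo.
have lk x y : link lev f (h x) (h y) = link lev' f' x y.
  by rewrite /link fh h_lev (inj_eq h_inj).
apply/conn_arcsP/conn_arcsP => -[/arcsP[ff fl _ nc] co]; split.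
- apply/arcsP; split=> [x|x _|x|x y xy yf ff'].
  + by apply: h_inj; rewrite -!fh ff.
  + by rewrite -h_lev -fh fl.
  + by rewrite inE.
  + by apply: (nc (h x) (h y)); rewrite ?fh h_lt.
- move=> x y _ _; have xy := co _ _ (hV x) (hV y).
  have [z [/h_inj<- //]] : exists z, h y = h z /\ connect (link lev' f') x z.
  (* A path starting in the image of [h] stays there, since each link leads to a position whose
     level is again in [V]; so it can be pulled back step by step. *)
  apply/asboolP; apply: (connect_closed (e := link lev f) (x := h x)
    (P := fun u => `[< exists z, u = h z /\ connect (link lev' f') x z >])) => //.
    move=> u v uv /asboolP[z [uz xz]]; apply/asboolP.
    have /h_im[t vt] : lev v \in V.
      move: uv; rewrite uz /link fh => /orP[/eqP->|/eqP<-]; exact: hV.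
    exists t; split=> //; apply: connect_trans xz (connect1 _).
    by rewrite -lk -uz -vt.
  by apply/asboolP; exists x; rewrite connect0.
- apply/arcsP; split=> // [y|y /h_im[x ->]|y z].
  + have [/h_im[x ->]|/fo e] := boolP (lev y \in V); last by rewrite !e.
    by rewrite !fh ff.
  + by rewrite fh h_lev fl ?inE.
  + have [/h_im[x ->]|/fo ->] := boolP (lev y \in V); last first.
      by move=> yz zy; have := ltn_trans yz zy; rewrite ltnn.
    have [/h_im[t ->]|/fo ->] := boolP (lev z \in V); last first.
      by move=> _ /ltn_trans h1 /h1; rewrite ltnn.
    by rewrite !fh !h_lt; exact: nc.
- move=> _ _ /h_im[x ->] /h_im[y ->].
  have xy := co x y (in_setT _) (in_setT _).
  apply: (connect_closed (e := link lev' f') (x := x)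
    (P := fun z => connect (link lev f) (h x) (h z))) => //.
  by move=> u v uv xu; apply: connect_trans xu (connect1 _); rewrite lk.
Qed.

Lemma card_conn_arcs_relabel :
  #|conn_arcs lev V| = #|conn_arcs lev' [set: 'I_p']|.
Proof.
(* Transport of [f'] along [h], with the identity off the image of [h]. *)
pose push (f' : {ffun 'I_m' -> 'I_m'}) : {ffun 'I_m -> 'I_m} :=
  [ffun y => if [pick x | h x == y] is Some x then h (f' x) else y].
have pushh f' x : push f' (h x) = h (f' x).
  rewrite ffunE; case: pickP => [z /eqP/h_inj->//|/(_ x)].
  by rewrite eqxx.
have pusho f' y : lev y \notin V -> push f' y = y.
  by rewrite ffunE; case: pickP => // x /eqP<-; rewrite hV.
rewrite -[RHS](card_in_imset (f := push)); last first.
  move=> f g _ _ /ffunP e; apply/ffunP=> x; apply: h_inj.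
  by rewrite -!pushh e.
apply: eq_card => f; apply/idP/imsetP => [fV|[f' f'c ->]]; last first.
  by rewrite (conn_arcs_relabel (pushh f') (pusho f')).
have /conn_arcsP[fa _] := fV; have [_ _ fo _] := arcsP _ _ _ fa.
have ex x : exists z, f (h x) == h z.
  have /h_im[z ->] : lev (f (h x)) \in V by rewrite (arcs_lev _ fa).
  by exists z.
pose f' := [ffun x => xchoose (ex x)].
have fh x : f (h x) = h (f' x) by rewrite ffunE; apply/eqP/(xchooseP (ex x)).
exists f'; first by rewrite -(conn_arcs_relabel fh fo).
apply/ffunP=> y; have [/h_im[x ->]|yV] := boolP (lev y \in V).
  by rewrite pushh fh.
by rewrite pusho ?fo.
Qed.

End Relabel.

(** * Levels of positions: the map [f_r] with positions and levels counted from 0 *)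

Fixpoint levn (r : seq posnat) (x : nat) : nat :=
  if r is a :: r' then if x < val a then 0 else (levn r' (x - val a)).+1 else 0.

Lemma weight_cons (a : posnat) r : weight (a :: r) = val a + weight r.
Proof. exact: big_cons. Qed.

Lemma levn_bounds r x : x < weight r ->
  levn r x < size r /\ weight (take (levn r x) r) <= x < weight (take (levn r x).+1 r).
Proof.
elim: r x => [|a r IH] x /=; first by rewrite /weight big_nil.
rewrite weight_cons => xr; case: ifPn => [xa|].
  by rewrite take0 weight_cons {1}/weight big_nil /= (leq_trans xa) // leq_addr.
rewrite -leqNgt => ax; have /IH[h1 h2] : x - val a < weight r by rewrite ltn_subLR.
by rewrite !weight_cons -leq_subRL // -ltn_subLR // h1.
Qed.

Lemma levn_level_set r (x : 'I_(weight r)) k : (x \in level_set r k) = (levn r x == k).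
Proof.
have [_ h] := levn_bounds (ltn_ord x).
have xl : x \in level_set r (levn r x) by rewrite inE.
by apply/idP/eqP => [xk|<-//]; exact: level_set_uniq xl xk.
Qed.

Lemma levn_mono r x y : x <= y -> y < weight r -> levn r x <= levn r y.
Proof.
move=> xy yr; have xr := leq_ltn_trans xy yr.
have [_ /andP[h1 _]] := levn_bounds xr; have [_ /andP[_ h2]] := levn_bounds yr.
rewrite leqNgt; apply/negP=> /(weight_take r) h3.
by move: (leq_trans h2 h3) => /leq_trans/(_ h1); rewrite ltnNge xy.
Qed.

Definition posnat1 : posnat := exist (fun n => 0 < n) 1 isT.

Lemma weight_takeS r k : k < size r ->
  weight (take k.+1 r) = weight (take k r) + val (nth posnat1 r k).
Proof. by move=> kr; rewrite (take_nth posnat1) // -cats1 weight_cat /weight big_seq1. Qed.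

Lemma offset_lt r k j : k < size r -> j < val (nth posnat1 r k) ->
  weight (take k r) + j < weight r.
Proof.
move=> kr jk; have := weight_take r kr; rewrite take_size weight_takeS //.
by move=> h; apply: leq_trans h; rewrite ltn_add2l.
Qed.

Lemma levn_offset r k j : k < size r -> j < val (nth posnat1 r k) ->
  levn r (weight (take k r) + j) = k.
Proof.
move=> kr jk; apply/eqP; have lt := offset_lt kr jk.
rewrite -[_ + j]/(val (Ordinal lt)) -levn_level_set inE /= leq_addr.
by rewrite weight_takeS // ltn_add2l.
Qed.

Definition lev r (x : 'I_(weight r)) : 'I_(size r) :=
  Ordinal (proj1 (levn_bounds (ltn_ord x))).

Lemma lev_mono r (x y : 'I_(weight r)) : x <= y -> lev x <= lev y.
Proof. by move=> xy; exact: levn_mono. Qed.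

Lemma lev_start_subproof r (k : 'I_(size r)) : weight (take k r) < weight r.
Proof.
by rewrite -[X in X < _]addn0 offset_lt //; case: (nth posnat1 r k).
Qed.

Definition lev_start r (k : 'I_(size r)) : 'I_(weight r) :=
  Ordinal (lev_start_subproof k).

Lemma lev_startK r : cancel (@lev_start r) (@lev r).
Proof.
move=> k; apply: val_inj => /=; rewrite -[X in levn r X]addn0 levn_offset //.
by case: (nth posnat1 r k).
Qed.

Lemma same_block_hat1_vec r (x y : 'I_(weight r)) :
  same_block (hat1_vec r) x y = (lev x == lev y).
Proof.
have [_ tH _] := and3P (hat1_vec_partition r).
rewrite /same_block (@def_pblock _ _ (level_set r (lev x))) //.
- by rewrite levn_level_set eq_sym -val_eqE.
- exact: imset_f.
- by rewrite levn_level_set.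
Qed.

Lemma same_block_arc_blocks m (f : {ffun 'I_m -> 'I_m}) x y : fixfree_inv f ->
  same_block (arc_blocks f) x y = (y == x) || (y == f x).
Proof. by move=> hf; rewrite /same_block pblock_arc_blocks // !inE. Qed.

Lemma arcs_fixfree m p (l : 'I_m -> 'I_p) f :
  f \in arcs l [set: 'I_p] -> fixfree_inv f.
Proof.
move=> /arcsP[ff fl _ _]; split=> // x; apply: contraNneq (fl x (in_setT _)).
by move=> ->.
Qed.

Lemma arc_blocks_NC2 r (f : {ffun 'I_(weight r) -> 'I_(weight r)}) : fixfree_inv f ->
  (arc_blocks f \in NC2 r) = (f \in arcs (@lev r) [set: 'I_(size r)]).
Proof.
move=> hf; have pf := arc_blocks_partition hf; have [ff f0] := hf.
rewrite inE arc_blocks_pairing //=.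
apply/andP/arcsP => [[/(arc_blocks_noncrossing hf) nc]|[_ fl _ nc]].
  move=> /(part_meet_hat0 pf (hat1_vec_partition r)) h; split=> // x; last by rewrite inE.
  move=> _; apply/negP=> e; have := f0 x; rewrite (h x (f x)) ?eqxx //.
    by rewrite same_block_arc_blocks // eqxx orbT.
  by rewrite same_block_hat1_vec eq_sym.
split; first exact/(arc_blocks_noncrossing hf).
apply/(part_meet_hat0 pf (hat1_vec_partition r)) => x y.
rewrite same_block_arc_blocks // same_block_hat1_vec => /orP[/eqP//|/eqP->].
by rewrite eq_sym (negPf (fl _ _)) ?inE.
Qed.

Lemma NC2_arcs r : NC2 r = arc_blocks @: arcs (@lev r) [set: 'I_(size r)].
Proof.
apply/setP=> P; apply/idP/imsetP=> [PN|[f fa ->]]; last first.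
  by rewrite arc_blocks_NC2 //; exact: arcs_fixfree fa.
have : pairing P by move: PN; rewrite inE => /and3P[].
move=> /pairing_arc_blocks[f hf PE]; exists f => //.
by rewrite -arc_blocks_NC2 // -PE.
Qed.

Lemma card_NC2 r : #|NC2 r| = #|arcs (@lev r) [set: 'I_(size r)]|.
Proof.
rewrite NC2_arcs card_in_imset // => f g fa ga.
exact: arc_blocks_inj (arcs_fixfree fa) (arcs_fixfree ga).
Qed.

Lemma arc_blocks_conn r (f : {ffun 'I_(weight r) -> 'I_(weight r)}) :
  0 < size r -> fixfree_inv f ->
  reflect (forall x y, connect (link (@lev r) f) x y)
    (part_join (arc_blocks f) (hat1_vec r) == hat1 (weight r)).
Proof.
move=> r0 hf; pose x0 := lev_start (Ordinal r0).
have lk x y : connect (fun x y => same_block (arc_blocks f) x y ||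
    same_block (hat1_vec r) x y) x y = connect (link (@lev r) f) x y.
  apply: eq_connect => u v; rewrite same_block_arc_blocks // same_block_hat1_vec.
  by rewrite /link; have [->|] := eqVneq v u; rewrite ?eqxx ?orbT ?eqxx ?orbT.
apply: (iffP (part_join_hat1 x0 (arc_blocks_partition hf) (hat1_vec_partition r))).
  by move=> h x y; rewrite -lk.
by move=> h x y; rewrite lk.
Qed.

Lemma card_NC2star r : 0 < size r ->
  #|NC2star r| = #|conn_arcs (@lev r) [set: 'I_(size r)]|.
Proof.
move=> r0; rewrite -(card_in_imset (f := arc_blocks)); last first.
  move=> f g /conn_arcsP[fa _] /conn_arcsP[ga _].
  exact: arc_blocks_inj (arcs_fixfree fa) (arcs_fixfree ga).
apply: eq_card => P; rewrite inE NC2_arcs; apply/andP/imsetP.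
  move=> [/imsetP[f fa ->]] /(arc_blocks_conn r0 (arcs_fixfree fa)) co.
  by exists f => //; apply/conn_arcsP.
move=> [f /conn_arcsP[fa co] ->]; split; first exact: imset_f.
by apply/(arc_blocks_conn r0 (arcs_fixfree fa)) => x y; apply: co; rewrite inE.
Qed.

(** Indices are plain numbers, so that [V] may be a set of ['I_p] for [p] only provably equal to
    [size r]. *)
Definition subvec (r : seq posnat) (s : seq nat) : seq posnat :=
  [seq nth posnat1 r i | i <- s].

Section Subvec.
Variables (r : seq posnat) (V : {set 'I_(size r)}).
Let s : seq nat := [seq val i | i <- enum V].
Let r' := subvec r s.

Let sizer' : size r' = size s. Proof. exact: size_map. Qed.

Let s_sorted : sorted ltn s.
Proof.
have h : sorted (relpre val ltn) (enum 'I_(size r)).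
  by rewrite -sorted_map val_enum_ord iota_ltn_sorted.
have -> : s = [seq val i | i <- enum 'I_(size r) & i \in V] by rewrite enumT.
rewrite sorted_map; apply: (sorted_filter _ _ h).
by move=> i j k; exact: ltn_trans.
Qed.

Let s_mem k : (k \in s) = [exists i : 'I_(size r), (val i == k) && (i \in V)].
Proof.
apply/mapP/existsP => [[i iV ->]|[i /andP[/eqP<- iV]]].
  by exists i; rewrite eqxx -mem_enum.
by exists i; rewrite ?mem_enum.
Qed.

Let s_lt k : k < size s -> nth 0 s k < size r.
Proof.
move=> /(mem_nth 0); rewrite s_mem => /existsP[i /andP[/eqP<- _]].
exact: ltn_ord.
Qed.

Let nth_r' k : k < size s -> nth posnat1 r' k = nth posnat1 r (nth 0 s k).
Proof. exact: nth_map. Qed.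

(** A position keeps its offset inside its block, and the block is moved to the place in [r] it
    comes from. *)
Let emb_nat x' :=
  weight (take (nth 0 s (levn r' x')) r) + (x' - weight (take (levn r' x') r')).

Let emb_aux x' : x' < weight r' ->
  levn r' x' < size s /\
  x' - weight (take (levn r' x') r') < val (nth posnat1 r (nth 0 s (levn r' x'))).
Proof.
move=> /levn_bounds[k1 /andP[b1 b2]]; rewrite -sizer'; split=> //.
rewrite -nth_r' -?sizer' // ltn_subLR //.
by rewrite -weight_takeS.
Qed.

Let emb_lt (x' : 'I_(weight r')) : emb_nat x' < weight r.
Proof. by have [k1 b] := emb_aux (ltn_ord x'); apply: offset_lt; rewrite ?s_lt. Qed.

Let emb x' := Ordinal (emb_lt x').

Let lev_emb x' : levn r (emb x') = nth 0 s (levn r' x').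
Proof. by have [k1 b] := emb_aux (ltn_ord x'); apply: levn_offset; rewrite ?s_lt. Qed.

(** Relabelling along [emb], which is increasing because [s] is sorted and separates levels because
    [s] has no repetition. *)
Lemma card_conn_arcs_subvec : V != set0 ->
  #|conn_arcs (@lev r) V| = #|NC2star r'|.
Proof.
move=> V0; have s_uniq : uniq s by rewrite (sorted_uniq ltn_trans ltnn).
have r'0 : 0 < size r' by rewrite sizer' size_map -cardE card_gt0.
rewrite card_NC2star //; apply: (@card_conn_arcs_relabel _ _ _ _ _ _ _ emb).
- move=> x y xy; have [kx bx] := emb_aux (ltn_ord x).
  have [ky by_] := emb_aux (ltn_ord y).
  have := levn_mono (ltnW xy) (ltn_ord y); rewrite leq_eqVlt => /orP[/eqP e|lt].
    rewrite /= /emb_nat -e ltn_add2l; apply: ltn_sub2r => //.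
    by rewrite (leq_ltn_trans _ xy) //; have [_ /andP[]] := levn_bounds (ltn_ord x).
  rewrite ltnNge; apply/negP=> /lev_mono; rewrite /= !lev_emb leqNgt.
  by rewrite (sorted_ltn_nth ltn_trans 0 s_sorted) ?inE.
- move=> x y; rewrite -!val_eqE /= !lev_emb.
  have [kx _] := emb_aux (ltn_ord x); have [ky _] := emb_aux (ltn_ord y).
  by rewrite nth_uniq.
- move=> y; have [ly /andP[b1 b2]] := levn_bounds (ltn_ord y).
  have -> : (lev y \in V) = (levn r y \in s).
    rewrite s_mem; apply/idP/existsP => [yV|[i /andP[/eqP e iV]]].
      by exists (lev y); rewrite eqxx yV.
    by rewrite (_ : lev y = i) //; apply: val_inj.
  apply: (iffP idP) => [ys|[x ->]]; last first.
    by rewrite lev_emb mem_nth //; have [] := emb_aux (ltn_ord x).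
  have ks : index (levn r y) s < size s by rewrite index_mem.
  have jk : y - weight (take (levn r y) r) < val (nth posnat1 r' (index (levn r y) s)).
    by rewrite nth_r' // nth_index // ltn_subLR // -weight_takeS.
  (* The preimage of [y] has the same offset, in the block of [r'] numbered by the index of the
     level of [y] in [s]. *)
  rewrite -sizer' in ks; exists (Ordinal (offset_lt ks jk)); apply: val_inj.
  rewrite /= /emb_nat levn_offset // nth_index //.
  by rewrite addKn subnKC.
Qed.

End Subvec.

(** The separate variable [p] allows [size (map N r)] in place of [size r] when comparing with the
    cumulants of [map N r]. *)
Lemma card_NC2_sum (p : nat) (r : seq posnat) : p = size r ->
  #|NC2 r| = \sum_(Q in NC p) \prod_(V in Q)
    #|NC2star (subvec r [seq val i | i <- enum V])|.
Proof.
move=> ->; rewrite card_NC2 (card_arcs (@lev_mono r) (@lev_startK r)).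
apply: eq_bigr => Q QNC; apply: eq_bigr => V VQ.
rewrite card_conn_arcs_subvec //.
by move: QNC; rewrite inE => /andP[/partition_neq0/(_ VQ)].
Qed.

(** * Counting words with trivial product *)

Section Words.
Variables (m n : nat).
Implicit Types (w : m.-tuple 'I_n) (f : {ffun 'I_m -> 'I_m}).

Definition letters (w : seq 'I_n) : seq nat := [seq (val i).+1 | i <- w].

Lemma letters_neq0 (w : seq 'I_n) : 0 \notin letters w.
Proof. by apply/mapP=> -[]. Qed.

Lemma nth_letters w (x : 'I_m) : nth 0 (letters w) x = (tnth w x).+1.
Proof.
by rewrite (nth_map (tnth w x)) ?size_tuple // -tnth_nth.
Qed.

Lemma count_letters w (x : 'I_m) :
  count_mem (tnth w x).+1 (letters w) = #|[set y | tnth w y == tnth w x]|.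
Proof.
rewrite count_map -[in LHS](map_tnth_enum w) count_map cardE -size_filter.
by rewrite enumT [in RHS]/enum_mem; congr size; apply: eq_filter => y /=; rewrite inE.
Qed.

Lemma mem_letters w a : a \in letters w -> exists x, a = (tnth w x).+1.
Proof.
by move=> /mapP[i /tnthP[x ->] ->]; exists x.
Qed.

Definition kernel_is f w : bool :=
  [forall x, forall y, (tnth w x == tnth w y) == ((y == x) || (y == f x))].

Lemma kernel_isP f w : reflect
  (forall x y, (tnth w x == tnth w y) = ((y == x) || (y == f x))) (kernel_is f w).
Proof. by apply: (iffP 'forall_'forall_eqP). Qed.

Lemma kernel_is_paired f w : fixfree_inv f -> kernel_is f w -> paired (letters w).
Proof.
move=> [_ f0] /kernel_isP kw _ /mem_letters[x ->]; rewrite count_letters.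
rewrite (_ : [set _ | _] = [set x; f x]) ?cards2; last first.
  by apply/setP=> y; rewrite !inE eq_sym kw.
by rewrite [x == _]eq_sym f0.
Qed.

Lemma paired_kernel w : paired (letters w) -> exists2 f, fixfree_inv f & kernel_is f w.
Proof.
move=> pw; pose S x := [set y | tnth w y == tnth w x].
have S2 x : #|S x| = 2.
  rewrite -count_letters; apply: pw; apply/mapP; exists (tnth w x) => //.
  exact: mem_tnth.
have ex x : exists y, (y != x) && (S x == [set x; y]).
  have /eqP/cards2P[y [z [yz e]]] := S2 x.
  have : x \in S x by rewrite inE.
  rewrite e => /set2P[->|->].
    by exists z; rewrite eq_sym yz eqxx.
  by exists y; rewrite yz setUC eqxx.
pose f := [ffun x => xchoose (ex x)].
have fP x : f x != x /\ S x = [set x; f x].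
  by rewrite ffunE; have /andP[? /eqP] := xchooseP (ex x).
have kw x y : (tnth w x == tnth w y) = ((y == x) || (y == f x)).
  by have [_ /setP/(_ y)] := fP x; rewrite !inE eq_sym.
exists f; last exact/kernel_isP.
split=> x; last by have [] := fP x.
have e : tnth w (f x) = tnth w x by apply/esym/eqP; rewrite kw eqxx orbT.
have := kw (f x) x; rewrite e eqxx => /esym/orP[/eqP xf|/eqP<-//].
by have [] := fP x; rewrite -xf eqxx.
Qed.

Lemma kernel_is_inj f g w : fixfree_inv f ->
  kernel_is f w -> kernel_is g w -> f = g.
Proof.
move=> [_ f0] /kernel_isP kf /kernel_isP kg; apply/ffunP=> x.
have := kf x (f x); rewrite eqxx orbT kg => /orP[/eqP fx|/eqP//].
by have := f0 x; rewrite fx eqxx.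
Qed.

Lemma kernel_crossing f w : fixfree_inv f -> kernel_is f w ->
  crossing (letters w) <-> exists x y : 'I_m, [/\ x < y, y < f x & f x < f y].
Proof.
move=> [ff f0] /kernel_isP kw; rewrite crossing_nth; split.
  move=> [i [j [k [l]]]]; rewrite size_map size_tuple => -[/and4P[ij jk kl lm]].
  have km := ltn_trans kl lm; have jm := ltn_trans jk km.
  have im := ltn_trans ij jm.
  rewrite (nth_letters w (Ordinal im)) (nth_letters w (Ordinal jm)).
  rewrite (nth_letters w (Ordinal km)) (nth_letters w (Ordinal lm)).
  move=> [/val_inj/eqP e1] [/val_inj/eqP e2] _; exists (Ordinal im), (Ordinal jm).
  move: e1 e2; rewrite !kw -!val_eqE /=.
  rewrite (gtn_eqF (ltn_trans ij jk)) (gtn_eqF (ltn_trans jk kl)) /=.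
  by move=> /eqP<- /eqP<-.
move=> [x [y [xy yfx fxy]]]; exists x, y, (f x), (f y).
rewrite xy yfx fxy size_map size_tuple ltn_ord !nth_letters; split=> //.
- by congr _.+1; apply/eqP; rewrite val_eqE kw eqxx orbT.
- by congr _.+1; apply/eqP; rewrite val_eqE kw eqxx orbT.
by rewrite eqSS val_eqE kw -!val_eqE /= (gtn_eqF xy) (ltn_eqF yfx).
Qed.

(** The involution exchanges the left ends of its arcs with the right ends. *)
Lemma fixfree_card f : fixfree_inv f -> m = #|[set x : 'I_m | x < f x]|.*2.
Proof.
move=> [ff f0]; set D := [set _ | _].
have DC : ~: D = f @: D.
  apply/setP=> x; rewrite !inE -leqNgt; apply/idP/imsetP => [fx|[y]].
    exists (f x); rewrite ?inE ff // ltn_neqAle fx andbT.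
    by have := f0 x; rewrite -val_eqE.
  by rewrite inE => yf ->; rewrite ff ltnW.
rewrite -[LHS]card_ord -(cardsC D) DC card_imset ?addnn //.
exact: can_inj ff.
Qed.

(** Such a word amounts to an injective choice of letters for the [m./2] arcs, indexed by their left
    ends. *)
Lemma card_kernel_is f : fixfree_inv f -> #|[set w | kernel_is f w]| = n ^_ m./2.
Proof.
move=> hf; have [ff f0] := hf; have cD := fixfree_card hf.
set D := [set _ | _] in cD.
(* The left end of the arc through [x]; two positions have the same [q] exactly when they are equal
   or paired. *)
pose q (x : 'I_m) := if x < f x then x else f x.
have qD x : q x \in D.
  rewrite /q inE; case: ifPn => //; rewrite -leqNgt ff leq_eqVlt => /orP[|//].
  by rewrite val_eqE (negPf (f0 x)).
have qq x y : (q x == q y) = (y == x) || (y == f x).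
  have qx : q x = x \/ q x = f x by rewrite /q; case: ifP; [left | right].
  have qy : q y = y \/ q y = f y by rewrite /q; case: ifP; [left | right].
  have qE z : q (f z) = q z.
    rewrite /q ff; case: (ltngtP z (f z)) => // /val_inj e.
    by have := f0 z; rewrite -e eqxx.
  apply/eqP/orP => [e|[/eqP->|/eqP->]] //.
  case: qx e => ->; case: qy => -> e.
  - by left; rewrite e.
  - by right; rewrite e ff.
  - by right; rewrite e.
  - by left; rewrite -[y]ff -e ff.
pose T := {x | x \in D}.
pose qT x : T := exist _ (q x) (qD x).
pose up (c : {ffun T -> 'I_n}) : m.-tuple 'I_n := [tuple c (qT x) | x < m].
pose I := [set c : {ffun T -> 'I_n} | injectiveb c].
transitivity #|up @: I|; last first.
  rewrite card_in_imset => [|c1 c2 _ _ e].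
    by rewrite card_inj_ffuns card_sig card_ord (congr1 half cD) doubleK.
  apply/ffunP=> -[x xD]; have := congr1 (fun w => tnth w x) e.
  rewrite !tnth_mktuple (_ : qT x = exist _ x xD) //.
  by apply: val_inj; move: xD; rewrite /= /q inE => ->.
apply: eq_card => w; rewrite inE; apply/kernel_isP/imsetP.
  move=> kw; pose c := [ffun u : T => tnth w (val u)].
  exists c.
    rewrite inE; apply/injectiveP=> -[x xD] [y yD]; rewrite !ffunE /= => /eqP.
    rewrite kw => /orP[/eqP e|/eqP e]; apply: val_inj => //=.
    move: xD yD; rewrite !inE e ff => h1 h2.
    by have := ltn_trans h1 h2; rewrite ltnn.
  apply: eq_from_tnth => x; rewrite tnth_mktuple ffunE /=; apply/eqP; rewrite kw.
  by rewrite /q; case: ifP; rewrite eqxx ?orbT.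
move=> [c]; rewrite inE => /injectiveP ci -> x y; rewrite !tnth_mktuple.
by rewrite (inj_eq ci) -qq.
Qed.

(** A word with at most [k] letters factors through [k] labels: a map from positions to labels, then
    one from labels to letters. *)
Lemma card_few_letters (k : nat) : 0 < m ->
  #|[set w : m.-tuple 'I_n | #|[set tnth w x | x in 'I_m]| <= k]| <= k ^ m * n ^ k.
Proof.
(* For [k = 0] the bound is 0 because [m > 0], and a nonempty word has at least one letter. *)
move=> m0; case: k => [|k].
  rewrite exp0n // mul0n eq_card0 // => w; rewrite inE leqn0 cards_eq0.
  apply/negP=> /eqP/setP/(_ (tnth w (Ordinal m0))).
  by rewrite imset_f // inE.
pose X := ({ffun 'I_m -> 'I_k.+1} * {ffun 'I_k.+1 -> 'I_n})%type.
pose F (u : X) : m.-tuple 'I_n := [tuple u.2 (u.1 x) | x < m].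
apply: (@leq_trans #|F @: [set: X]|); last first.
  apply: leq_trans (leq_imset_card _ _) _.
  by rewrite cardsT card_prod !card_ffun !card_ord.
apply/subset_leq_card/fintype.subsetP=> w; rewrite inE => wk.
set I := [set _ | _ in _] in wk.
have wI x : tnth w x \in I by exact: imset_f.
pose a0 := tnth w (Ordinal m0).
(* A position is labelled by the rank of its letter in [enum I]; labels beyond the size of [I] get
   the default [a0]. *)
apply/imsetP; exists ([ffun x => inord (index (tnth w x) (enum I))],
   [ffun i : 'I_k.+1 => nth a0 (enum I) i]) => //.
apply: eq_from_tnth => x; rewrite tnth_mktuple !ffunE inordK ?nth_index ?mem_enum //.
by apply: leq_trans wk; rewrite cardE index_mem mem_enum.
Qed.

End Words.

(** * The words counted by the trace *)

Section GoodWords.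
Variables (r : seq posnat) (n : nat).
Notation m := (weight r).
Implicit Types (w : m.-tuple 'I_n).

Definition level_inj w : bool :=
  [forall x, forall y, (lev x == lev y) ==> (tnth w x == tnth w y) ==> (x == y)].

Lemma level_injP w : reflect
  (forall x y, lev x = lev y -> tnth w x = tnth w y -> x = y) (level_inj w).
Proof.
apply: (iffP 'forall_'forall_implyP) => h x y.
  by move=> /eqP xy /eqP wxy; have /implyP/(_ wxy)/eqP := h x y xy.
by move=> /eqP xy; apply/implyP=> /eqP wxy; rewrite (h x y).
Qed.

Definition good_words : {set m.-tuple 'I_n} :=
  [set w | level_inj w && `[< forall z, act (letters w) z = z >]].

Definition paired_words : {set m.-tuple 'I_n} :=
  [set w | [exists f in arcs (@lev r) [set: 'I_(size r)], kernel_is f w]].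

(** Double counting of the pairs formed by a pairing and a word with that kernel; a word determines
    its pairing. *)
Lemma card_paired_words : #|paired_words| = #|NC2 r| * n ^_ m./2.
Proof.
rewrite card_NC2 -sum_nat_const.
transitivity (\sum_(f in arcs (@lev r) [set: 'I_(size r)])
    \sum_(w : m.-tuple 'I_n | kernel_is f w) 1); last first.
  apply: eq_bigr => f /arcs_fixfree hf.
  by rewrite -(card_kernel_is _ hf) sum1dep_card cardsE.
rewrite (exchange_big_dep predT) //= -sum1_card big_mkcond /=.
apply: eq_bigr => w _; rewrite inE; case: ifPn => [/exists_inP[f fa kf]|].
  rewrite (big_pred1 f) // => g; apply/andP/eqP => [[ga kg]|->//].
  exact: kernel_is_inj (arcs_fixfree ga) kg kf.
rewrite negb_exists_in => /forall_inP h; rewrite big_pred0 // => f.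
by apply/andP=> -[/h/negP].
Qed.

(** For a paired word, trivial action means that the kernel is non-crossing, and injectivity on
    levels means that no arc stays in a level. *)
Lemma paired_wordsP w : reflect (w \in good_words /\ paired (letters w))
  (w \in paired_words).
Proof.
rewrite !inE; apply: (iffP exists_inP) =>
  [[f fa kf]|[/andP[/level_injP li /asboolP ai] pw]].
  have hf := arcs_fixfree fa; have [_ fl _ nc] := arcsP _ _ _ fa.
  have pw := kernel_is_paired hf kf; split=> //; apply/andP; split.
    apply/level_injP=> x y xy /eqP; rewrite (kernel_isP _ _ kf) => /orP[/eqP//|/eqP yx].
    by have := fl x; rewrite inE -yx xy eqxx => /(_ isT).
  apply/asboolP/act_id_noncrossing=> //; first exact: letters_neq0.
  move/(kernel_crossing hf kf) => [x [y [xy yfx fxy]]].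
  exact: nc xy yfx fxy.
have [f hf kf] := paired_kernel pw; exists f => //; apply/arcsP.
have [ff f0] := hf; split=> [//|x _|x|x y xy yfx fxy].
- apply: contra (f0 x) => /eqP e; rewrite (li (f x) x) //.
  by apply/esym/eqP; rewrite (kernel_isP _ _ kf) eqxx orbT.
- by rewrite inE.
move: ai => /act_id_noncrossing; apply=> //; first exact: letters_neq0.
by apply/(kernel_crossing hf kf); exists x, y.
Qed.

(** Each letter of a good word occurs at least twice, and in an unpaired one some letter occurs
    three times, so twice the number of letters is less than [m]. *)
Lemma good_unpaired_few_letters w : w \in good_words -> w \notin paired_words ->
  #|[set tnth w x | x in 'I_m]| <= m.-1./2.
Proof.
move=> wg wp; set I := [set _ | _ in _].
have ge2 x : 2 <= #|[set y | tnth w y == tnth w x]|.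
  rewrite -count_letters; apply: act_id_count.
  - exact: letters_neq0.
  - by move: wg; rewrite inE => /andP[_ /asboolP].
  - by apply: map_f; exact: mem_tnth.
have [x0 gt2] : exists x, 2 < #|[set y | tnth w y == tnth w x]|.
  apply/existsP; apply: contraNT wp; rewrite negb_exists => /forallP h.
  apply/paired_wordsP; split=> // _ /mem_letters[x ->].
  by rewrite count_letters; apply/eqP; rewrite eqn_leq ge2 leqNgt h.
have mE : m = \sum_(a in I) #|[set y | tnth w y == a]|.
  rewrite -[LHS]card_ord -sum1_card (partition_big (tnth w) (mem I)) /=.
    by apply: eq_bigr => a _; rewrite sum1dep_card cardsE.
  by move=> x _; exact: imset_f.
have : 2 * #|I| < m.
  rewrite [X in _ < X]mE (bigD1 (tnth w x0)) /=; last exact: imset_f.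
  rewrite [#|I|](cardD1 (tnth w x0)) imset_f // mulnDr muln1 -addSn leq_add //.
  rewrite mulnC -sum_nat_const; apply: (@leq_trans (\sum_(a in I | a != tnth w x0) 2)).
    by apply: eq_leq; apply: eq_bigl => a; rewrite !inE andbC.
  by apply: leq_sum => _ /andP[/imsetP[x _ ->] _].
by lia.
Qed.

(** The good words are the paired ones together with words on at most [m.-1./2] letters, which form
    the error term. *)
Lemma card_good_words : 0 < m ->
  #|NC2 r| * n ^_ m./2 <= #|good_words| <=
  #|NC2 r| * n ^_ m./2 + (m.-1./2) ^ m * n ^ m.-1./2.
Proof.
move=> m0; rewrite -card_paired_words.
have sub : paired_words \subset good_words.
  by apply/fintype.subsetP=> w /paired_wordsP[].
rewrite subset_leq_card //= -(cardsID paired_words) (setIidPr sub) leq_add2l.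
apply: leq_trans (card_few_letters _ _ m0).
apply/subset_leq_card/fintype.subsetP=> w; rewrite in_setD => /andP[wp wg].
by rewrite inE good_unpaired_few_letters.
Qed.

End GoodWords.

Lemma NC2_odd r : odd (weight r) -> #|NC2 r| = 0.
Proof.
move=> ro; apply: eq_card0 => P; rewrite NC2_arcs; apply/imsetP=> -[f fa _].
by move: ro; rewrite (fixfree_card (arcs_fixfree fa)) odd_double.
Qed.

(** * Asymptotics *)

Section Asymptotics.
Local Open Scope ring_scope.
Local Open Scope classical_set_scope.
Variable R : realType.
Local Notation sq n := (Num.sqrt (n%:R : R)).

Lemma cvg_ffact_ratio h :
  (fun n => (n.+1 ^_ h)%:R / n.+1%:R ^+ h : R) @ \oo --> (1 : R).
Proof.
elim: h => [|h IH].
  rewrite (_ : (fun _ => _) = fun=> 1); first exact: cvg_cst.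
  by apply/funext=> n; rewrite ffactn0 expr0 divr1.
have c : (fun n => 1 - h%:R * harmonic n : R) @ \oo --> (1 : R).
  rewrite -[X in _ --> X](subr0 1) -[X in _ - X](mulr0 h%:R).
  apply: cvgB; first exact: cvg_cst.
  by apply: cvgM; [exact: cvg_cst | exact: cvg_harmonic].
have cc := cvgM IH c; rewrite mulr1 in cc.
apply: cvg_trans; last exact: cc.
(* The truncated difference [n.+1 - h] in the falling factorial agrees with the real one once
   [h <= n.+1]. *)
apply: near_eq_cvg.
exists h => // n /= /leqW hn.
rewrite /= ffactnSr natrM natrB // exprSr /harmonic /=.
have n0 : n.+1%:R != 0 :> R by rewrite pnatr_eq0.
by rewrite invfM mulrACA mulrBl divff.
Qed.

(** The term is a power of [sq n.+1] with exponent at most -1, hence is bounded by the square root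
    of [harmonic n]. *)
Lemma cvg_small_power k m : (k.*2 < m)%N ->
  (fun n => n.+1%:R ^+ k * sq n.+1 ^- m : R) @ \oo --> (0 : R).
Proof.
move=> km.
have c : (fun n => Num.sqrt (harmonic n : R)) @ \oo --> (0 : R).
  rewrite -[X in _ --> X]sqrtr0; apply: (@continuous_cvg _ _ _ _ _ _ Num.sqrt).
    exact: sqrt_continuous.
  exact: cvg_harmonic.
apply: (squeeze_cvgr (f := fun=> 0)) c; last exact: cvg_cst.
apply: nearW => n; have n1 : 1 <= sq n.+1 by rewrite -[leLHS]sqrtr1 ler_wsqrtr // ler1n.
have s0 : 0 < sq n.+1 by exact: lt_le_trans n1.
rewrite mulr_ge0 ?exprn_ge0 ?invr_ge0 ?exprn_ge0 ?(ltW s0) //=.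
rewrite -{1}[n.+1%:R]sqr_sqrtr // -exprM mul2n.
rewrite ler_pdivrMr ?exprn_gt0 // /harmonic sqrtrV //.
rewrite mulrC ler_pdivlMr // -exprSr; exact: ler_weXn2l.
Qed.

Lemma cvg_good_words r : (0 < weight r)%N ->
  (fun n => sq n ^- weight r * #|good_words r n|%:R : R) @ \oo -->
  (#|NC2 r|%:R : R).
Proof.
move=> m0; set m := weight r; set N := #|NC2 r|.
(* Passing to [n.+1] keeps the denominators nonzero. *)
rewrite -cvg_shiftS /=.
pose k := (m.-1./2)%N; pose lo n : R := N%:R * (n.+1 ^_ m./2)%:R * sq n.+1 ^- m.
have km : (k.*2 < m)%N.
  by rewrite /k; move: m0; rewrite -/m; lia.
have clo : lo n @[n --> \oo] --> (N%:R : R).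
  (* Only for even [m] is [sq n ^+ m] equal to [n ^ m./2]; for odd [m] there is no pairing and the
     lower bound vanishes. *)
  have [mo|me] := boolP (odd m).
    rewrite /N NC2_odd // (_ : lo = fun=> 0); first exact: cvg_cst.
    by apply/funext=> n; rewrite /lo /N NC2_odd // !mul0r.
  rewrite -[X in _ --> X]mulr1.
  rewrite (_ : lo = fun n => N%:R * ((n.+1 ^_ m./2)%:R / n.+1%:R ^+ m./2)).
    by apply: cvgM; [exact: cvg_cst | exact: cvg_ffact_ratio].
  apply/funext=> n; rewrite /lo mulrA; congr (_ * _^-1).
  by rewrite -{1}(even_halfK me) -mul2n exprM sqr_sqrtr.
have chi : (fun n =>
    lo n + (k ^ m)%N%:R * (n.+1%:R ^+ k * sq n.+1 ^- m)) @ \oo --> (N%:R : R).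
  rewrite -[X in _ --> X]addr0 -[X in _ + X](mulr0 (k ^ m)%N%:R).
  apply: cvgD => //; apply: cvgM; first exact: cvg_cst.
  exact: cvg_small_power.
apply: (squeeze_cvgr _ clo chi); apply: nearW => n.
have /andP[h1 h2] := card_good_words n.+1 m0.
have s0 : 0 <= sq n.+1 ^- m by rewrite invr_ge0 exprn_ge0 // sqrtr_ge0.
rewrite /lo [sq n.+1 ^- m * _]mulrC mulrA -mulrDl -natrX -!natrM -natrD.
by rewrite !ler_wpM2r // ler_nat.
Qed.

Lemma cvg_real_complex (u : nat -> R) (l : R) : u @ \oo --> l ->
  (fun n => (u n)%:C%C : R[i]^o) @ \oo --> (l%:C%C : R[i]^o).
Proof.
move=> ul; apply/cvgrPdist_lt => e e0.
(* A positive element of [R[i]] is real, since the order requires equal imaginary parts. *)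
have eE : e = (complex.Re e)%:C%C.
  by move: e0; case: e => a b; rewrite ltcE /= => /andP[/eqP-> _].
have e0' : 0 < complex.Re e by move: e0; rewrite eE ltcR.
move/cvgrPdist_lt: ul => /(_ _ e0'); apply: filterS => n.
have nE (x : R) : `|x%:C%C : R[i]| = (`|x|)%:C%C.
  by rewrite normc_def /= expr0n addr0 sqrtr_sqr.
by rewrite -rmorphB => lt_e; rewrite eE; move: lt_e; rewrite -ltcR -nE.
Qed.

End Asymptotics.

Local Open Scope ring_scope.

(** * Traces of products of the M_r(n,1) *)

Fixpoint word_perm n (w : seq 'I_n) : finperm :=
  if w is i :: w' then (cycle_perm [:: 0%N; (val i).+1] * word_perm w')%g else 1%g.

Lemma word_permE n (w : seq 'I_n) : val (word_perm w) =1 act (letters w).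
Proof.
elim: w => // i w IH z.
rewrite -[LHS]/(val (cycle_perm _) (val (word_perm w) z)) IH cycle_permE //=.
Qed.

Lemma word_perm_cat n (u v : seq 'I_n) :
  word_perm (u ++ v) = (word_perm u * word_perm v)%g.
Proof. by elim: u => [|i u IH] /=; rewrite ?mul1g // IH mulgA. Qed.

Lemma word_perm_eq1 n (w : seq 'I_n) :
  (word_perm w == 1%g) = `[< forall z, act (letters w) z = z >].
Proof.
apply/eqP/asboolP => [e z|h]; first by rewrite -word_permE e.
by apply/val_inj/funext => z; rewrite word_permE h.
Qed.

Lemma cycle_perm_word n (a : seq 'I_n) : uniq a ->
  cycle_perm (0%N :: [seq (val i).+1 | i <- a]) = word_perm (rev a).
Proof.
move=> ua; have u : uniq (0%N :: letters a).
  rewrite /= letters_neq0 map_inj_uniq // => i j [] /val_inj //.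
apply/val_inj/funext => z; rewrite cycle_permE // word_permE.
by rewrite /letters map_rev act_rev_next.
Qed.

(** The condition [level_inj] in a form recursive in [r], suited to expanding a product factor by
    factor. *)
Fixpoint blocks_uniq (T : eqType) (r : seq posnat) (w : seq T) : bool :=
  if r is a :: r' then uniq (take (val a) w) && blocks_uniq r' (drop (val a) w)
  else true.

Lemma blocks_uniqP (T : eqType) (x0 : T) (r : seq posnat) (w : seq T) :
  size w = weight r ->
  reflect (forall x y, (x < weight r)%N -> (y < weight r)%N -> levn r x = levn r y ->
             nth x0 w x = nth x0 w y -> x = y) (blocks_uniq r w).
Proof.
elim: r w => [|a r IH] w sw /=.
  by left=> x y; rewrite /weight big_nil.
rewrite weight_cons in sw *.
have sd : size (drop (val a) w) = weight r by rewrite size_drop sw addKn.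
have st : size (take (val a) w) = val a.
  by rewrite size_take_min sw; apply/minn_idPl/leq_addr.
apply: (iffP andP) => [[ua /(IH _ sd) h] x y xr yr|h].
  case: ifPn => xa; case: ifPn => ya //.
    move=> _; rewrite -(nth_take x0 xa) -(nth_take x0 ya) => /eqP.
    by rewrite nth_uniq ?st // => /eqP.
  rewrite -!leqNgt in xa ya; move=> /succn_inj e.
  rewrite -(subnKC xa) -(subnKC ya) -!nth_drop => e'.
  congr addn; apply: h => //; by rewrite ltn_subLR.
split.
  apply/(uniqP x0) => x y; rewrite !inE st => xa ya; rewrite !nth_take // => e.
  by apply: h => //; rewrite ?xa ?ya // ltn_addr.
apply/(IH _ sd) => x y xr yr lxy; rewrite !nth_drop => e.
apply/(@addnI (val a))/h; rewrite ?ltn_add2l //.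
by rewrite !ltnNge !leq_addr /= !addKn lxy.
Qed.

Lemma blocks_uniq_level_inj r n (w : (weight r).-tuple 'I_n) :
  blocks_uniq r w = level_inj w.
Proof.
(* For [n = 0] there is no letter to serve as the default of [nth]. *)
case: (posnP n) => [n0|n0].
  move: w; rewrite n0 => w; case: r w => [|a r] w /=.
    by apply/esym/level_injP=> -[x xl]; exfalso; move: (xl); rewrite {1}/weight big_nil.
  suff : 'I_0 by case.
  apply: (tnth w); apply: (@Ordinal _ 0); rewrite weight_cons.
  by rewrite ltn_addr // (valP a).
pose x0 : 'I_n := Ordinal n0.
apply/(blocks_uniqP x0 (size_tuple w))/level_injP => h x y.
  move=> /(congr1 val) /= lxy; rewrite !(tnth_nth x0) => e.
  by apply: val_inj; apply: h; rewrite ?ltn_ord.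
move=> xr yr lxy e.
have := h (Ordinal xr) (Ordinal yr); rewrite !(tnth_nth x0) /= => h'.
suff : Ordinal xr = Ordinal yr by move/(congr1 val).
by apply: h' => //; apply: val_inj.
Qed.

Section Trace.
Variables (R : realType) (n : nat).
Local Notation sq := (Num.sqrt (n%:R : R)).

(** Reversal permutes the duplicate-free tuples and turns each cycle into the product of the
    transpositions in reading order. *)
Lemma Mrn_word (k : posnat) : Mrn R n k = (sq ^- val k)%:C%C *:
  \sum_(a : (val k).-tuple 'I_n | uniq a) Defs.basis R[i] (word_perm a).
Proof.
rewrite /Mrn; congr (_ *: _).
have rK : involutive (fun a : (val k).-tuple 'I_n => [tuple of rev a]).
  by move=> a; apply/val_inj/revK.
rewrite (reindex_inj (inv_inj rK)) /=.
rewrite (eq_bigl (fun a : (val k).-tuple 'I_n => uniq a)); last first.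
  by move=> a /=; rewrite rev_uniq.
by apply: eq_bigr => a ua; rewrite cycle_perm_word ?rev_uniq // revK.
Qed.

(** Expanding the product concatenates the words of the factors, while the scalar factors multiply
    up to the exponent [weight r]. *)
Lemma Mrn_prod (r : seq posnat) m : m = weight r ->
  \prod_(k <- r) Mrn R n k = (sq ^- m)%:C%C *:
    \sum_(w : m.-tuple 'I_n | blocks_uniq r w) Defs.basis R[i] (word_perm w).
Proof.
elim: r m => [|a r IH] m ->.
  rewrite big_nil.
  have -> : weight [::] = 0%N by rewrite /weight big_nil.
  rewrite expr0 invr1 scale1r (big_pred1 [tuple]) // => w; by rewrite [w]tuple0.
rewrite weight_cons big_cons Mrn_word (IH _ erefl).
rewrite -scalerAl -scalerAr scalerA -rmorphM /= -invfM -exprD.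
congr (_ *: _); rewrite mulr_suml.
rewrite (eq_bigr (fun u : (val a).-tuple 'I_n =>
  \sum_(v : (weight r).-tuple 'I_n | blocks_uniq r v)
  Defs.basis R[i] (word_perm u) * Defs.basis R[i] (word_perm v))); last first.
  by move=> u _; rewrite big_distrr.
rewrite pair_big /=.
(* Concatenation is injective between sets of equal cardinality, hence bijective, and so allows
   reindexing. *)
pose cat2 (u : (val a).-tuple 'I_n * (weight r).-tuple 'I_n) := [tuple of u.1 ++ u.2].
have tk (u : (val a).-tuple 'I_n) (v : seq 'I_n) : take (val a) (u ++ v) = u.
  by rewrite take_size_cat ?size_tuple.
have dr (u : (val a).-tuple 'I_n) (v : seq 'I_n) : drop (val a) (u ++ v) = v.
  by rewrite drop_size_cat ?size_tuple.
have cat2_bij : bijective cat2.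
  apply: inj_card_bij => [[u1 u2] [v1 v2] /(congr1 val) /= e|].
    have := congr1 (take (val a)) e; have := congr1 (drop (val a)) e.
    by rewrite !tk !dr => /val_inj-> /val_inj->.
  by rewrite card_prod !card_tuple expnD.
rewrite [RHS](reindex cat2) /=; last exact: onW_bij.
apply: eq_big => [[u v]|[u v] _] /=; first by rewrite tk dr.
by rewrite basisM word_perm_cat.
Qed.

(** The coefficient of the identity selects the words with trivial product. *)
Lemma trace_Mrn_prod (r : seq posnat) :
  canonical_trace (\prod_(k <- r) Mrn R n k) =
  (sq ^- weight r * #|good_words r n|%:R)%:C%C.
Proof.
rewrite (Mrn_prod erefl) /canonical_trace Defs.coefZ Defs.coef_sum rmorphM; congr (_ * _).
rewrite rmorph_nat -sum1_card natr_sum big_mkcond [RHS]big_mkcond.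
apply: eq_bigr => w _; rewrite inE blocks_uniq_level_inj -word_perm_eq1.
by case: ifP => //= _; rewrite coef_basis; case: eqP.
Qed.

End Trace.

(** * Moments and cumulants *)

Section Moments.
Variables (R : realType).

Lemma supp_monomial (r : free_monoid posnat) :
  supp (Defs.basis R[i] r) = [fset r]%fset.
Proof.
apply/fsetP=> g; rewrite -coef_supp coef_basis in_fset1 [g == r]eq_sym.
by case: (r == g); rewrite ?mulr1n ?mulr0n ?oner_eq0 ?eqxx.
Qed.

Lemma nc_eval_monomial (A : algType R[i]) (M : posnat -> A) (r : seq posnat) :
  nc_eval M (Defs.basis R[i] (r : free_monoid posnat)) = \prod_(k <- r) M k.
Proof.
by rewrite /nc_eval supp_monomial big_seq_fset1 coef_basis eqxx scale1r.
Qed.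

(** On a monomial the hypothesis says that the traces of products of the [Mrn] converge to the
    moment; their limit is already known, and limits are unique. *)
Lemma limit_family_moment (A : nc_prob_space R) (M : posnat -> A) (r : seq posnat) :
  is_limit_family M -> (0 < size r)%N ->
  state A (\prod_(k <- r) M k) = #|NC2 r|%:R.
Proof.
move=> Mlim r0; have := Mlim (Defs.basis R[i] (r : free_monoid posnat)).
rewrite nc_eval_monomial => lim1.
have m0 : (0 < weight r)%N by exact: leq_ltn_trans (ltn_ord (lev_start (Ordinal r0))).
have := cvg_real_complex (cvg_good_words (R := R) m0).
rewrite (_ : (fun n => _) = (fun n => canonical_trace
    (nc_eval (Mrn R n) (Defs.basis R[i] (r : free_monoid posnat))))); last first.
  by apply/funext=> n; rewrite nc_eval_monomial trace_Mrn_prod.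
rewrite rmorph_nat => lim2.
exact: (cvg_unique (@norm_hausdorff _ R[i]^o) lim1 lim2).
Qed.

Variables (B : nc_prob_space R) (N : posnat -> B).

Lemma restrict_map (r : seq posnat) (V : {set 'I_(size (map N r))}) :
  Defs.restrict V = map N (subvec r [seq val i | i <- enum V]).
Proof.
rewrite /Defs.restrict /subvec -!map_comp; apply: eq_map => i /=.
by rewrite (tnth_nth 0) /= (nth_map posnat1) // -(size_map N).
Qed.

Lemma subvecT (r : seq posnat) p : p = size r ->
  subvec r [seq val i | i <- enum [set: 'I_p]] = r.
Proof.
move=> ->; rewrite (eq_enum (in_set _)) /subvec enumT.
rewrite (_ : [seq val i | i <- _] = iota 0 (size r)); last first.
  by rewrite -val_enum_ord enumT.
exact: mkseq_nth.
Qed.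

Lemma state_map_sum (r : seq posnat) : (0 < size r)%N ->
  state B (\prod_(k <- r) N k) = \sum_(Q in NC (size (map N r)))
    \prod_(V in Q) free_cumulant (map N (subvec r [seq val i | i <- enum V])).
Proof.
move=> r0; have a0 : (0 < size (map N r))%N by rewrite size_map.
rewrite -(big_map N xpredT id) (moment_free_cumulant a0).
by apply: eq_bigr => Q _; apply: eq_bigr => V _; rewrite restrict_map.
Qed.

Lemma card_NC2_sumR (r : seq posnat) :
  #|NC2 r|%:R = \sum_(Q in NC (size (map N r)))
    \prod_(V in Q) #|NC2star (subvec r [seq val i | i <- enum V])|%:R :> R[i].
Proof.
rewrite (card_NC2_sum (p := size (map N r))) ?size_map // natr_sum.
by apply: eq_bigr => Q _; rewrite natr_prod.
Qed.

Lemma size_subvec (r : seq posnat) p (V : {set 'I_p}) :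
  size (subvec r [seq val i | i <- enum V]) = #|V|.
Proof. by rewrite !size_map -cardE. Qed.

Lemma moments_of_cumulants :
  (forall r : seq posnat, (0 < size r)%N ->
     free_cumulant (map N r) = #|NC2star r|%:R) ->
  forall r : seq posnat, (0 < size r)%N ->
    state B (\prod_(k <- r) N k) = #|NC2 r|%:R.
Proof.
move=> cum r r0; rewrite state_map_sum // card_NC2_sumR.
apply: eq_bigr => Q; rewrite inE => /andP[/partition_neq0 Q0 _].
apply: eq_bigr => V /Q0; rewrite -card_gt0 => V0.
by rewrite cum // size_subvec.
Qed.

(** Induction on the length: partitions other than [hat1] have strictly shorter blocks, whose
    cumulants are known. *)
Lemma cumulants_of_moments :
  (forall r : seq posnat, (0 < size r)%N ->
    state B (\prod_(k <- r) N k) = #|NC2 r|%:R) ->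
  forall r : seq posnat, (0 < size r)%N ->
     free_cumulant (map N r) = #|NC2star r|%:R.
Proof.
move=> mom r; have [n] := ubnP (size r); elim: n r => // n IH r.
rewrite ltnS => rn r0.
have h1 : hat1 (size (map N r)) \in NC (size (map N r)).
  have pT : partition (hat1 (size (map N r))) [set: 'I_(size (map N r))].
    apply/and3P; split; rewrite ?inE.
    - by rewrite /cover big_set1.
    - by apply/trivIsetP=> B1 B2; rewrite !inE => /eqP-> /eqP->; rewrite eqxx.
    - by rewrite eq_sym -card_gt0 cardsT card_ord size_map.
  rewrite inE pT; apply/forall_inP=> B1; rewrite inE => /eqP->.
  by apply/forall_inP=> B2; rewrite inE => /eqP->; rewrite eqxx.
have e (Q : {set {set 'I_(size (map N r))}}) : (Q \in NC _) && (Q != hat1 _) ->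
    \prod_(V in Q) free_cumulant (map N (subvec r [seq val i | i <- enum V])) =
    \prod_(V in Q) #|NC2star (subvec r [seq val i | i <- enum V])|%:R.
  move=> /andP[QN Q1]; apply: eq_bigr => V VQ.
  have /andP[V0 Vr] := NC_proper_block QN Q1 VQ.
  apply: IH; rewrite size_subvec //; apply: leq_trans Vr _.
  by rewrite size_map.
have := mom r r0; rewrite state_map_sum // card_NC2_sumR.
(* Cancelling the equal sums over the other partitions leaves the two one-block terms. *)
rewrite (bigD1 _ h1) [in RHS](bigD1 _ h1) (eq_bigr _ e) => /addIr.
by rewrite !big_set1 subvecT ?size_map.
Qed.

(** By linearity it is enough to treat monomials, and on the empty one both states are 1. *)
Lemma same_distribution_moments (A : nc_prob_space R) (M : posnat -> A) :
  (forall r : seq posnat, (0 < size r)%N ->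
    state A (\prod_(k <- r) M k) = state B (\prod_(k <- r) N k)) ->
  same_distribution M N.
Proof.
move=> h P; rewrite /nc_eval !linear_sum /=; apply: eq_bigr => w _.
rewrite !linearZ /=; congr (_ * _).
case: (w : seq posnat) => [|k r]; last exact: h.
by rewrite !big_nil !state1.
Qed.

End Moments.

Theorem theorem2 (R : realType) (A : nc_prob_space R) (M : posnat -> A)
    (Msa : forall r : posnat, self_adjoint (M r))
    (Mlim : is_limit_family M) :
  [/\ forall (p : nat) (r : p.-tuple posnat), (1 <= p)%N ->
        state A (\prod_(k < p) M (tnth r k)) = #|NC2 r|%:R :> R[i],
      forall (p : nat) (r : p.-tuple posnat), (1 <= p)%N ->
        free_cumulant [seq M k | k <- r] = #|NC2star r|%:R :> R[i],
      forall (B : nc_prob_space R) (N : posnat -> B),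
        (forall (p : nat) (r : p.-tuple posnat), (1 <= p)%N ->
           state B (\prod_(k < p) N (tnth r k)) = #|NC2 r|%:R :> R[i]) ->
        same_distribution M N
    & forall (B : nc_prob_space R) (N : posnat -> B),
        (forall (p : nat) (r : p.-tuple posnat), (1 <= p)%N ->
           free_cumulant [seq N k | k <- r] = #|NC2star r|%:R :> R[i]) ->
        same_distribution M N].
Proof.
have momM r : (0 < size r)%N -> state A (\prod_(k <- r) M k) = #|NC2 r|%:R.
  exact: limit_family_moment.
split=> [p r p0|p r p0|B N momN|B N cumN].
- by rewrite -(big_tuple _ _ r xpredT M) momM // size_tuple.
- by rewrite (cumulants_of_moments momM) // size_tuple.
- apply: same_distribution_moments => r r0; rewrite momM //.
  by rewrite -(momN _ (in_tuple r) r0) -(big_tuple _ _ (in_tuple r) xpredT N).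
- apply: same_distribution_moments => r r0; rewrite momM // moments_of_cumulants //.
  by move=> s s0; rewrite (cumN _ (in_tuple s) s0).
Qed.
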